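(* Let $(\mathcal{X},\mathcal{B})$, $(\Theta,\mathcal{C})$, $P(\cdot\mid\theta)$, $\nu$, $M$, $Q(\cdot\mid x)$ and $R(\cdot\mid\eta)$ be as in the context. Let $f:\Theta\times\Theta\to[0,\infty)$ be a measurable function, and put $$\mathcal{T}(\eta)=\int_\Theta f(\theta,\eta)\,R(d\theta\mid\eta).$$ Assume: (i) for every $\varphi\in\Phi_f$ there exist measurable sets $K_1\subseteq K_2\subseteq\cdots$ with $\bigcup_i K_i=\Theta$ such that for all $i$, $0<\nu(K_i)<\infty$ and $\int_{K_i}\mathsf{R}(\hat\varphi;\theta)\,\nu(d\theta)<\infty$; (ii) $0<\mathcal{T}(\eta)<\infty$ for all $\eta\in\Theta$, and there exist measurable sets $K_1\subseteq K_2\subseteq\cdots$ with $\bigcup_i K_i=\Theta$ such that for all $i$, $0<\nu(K_i)<\infty$ and $\int_{K_i}\mathcal{T}(\eta)\,\nu(d\eta)<\infty$; (iii) there exists $\epsilon>0$ such that $\mathcal{T}(\eta)\ge\epsilon$ except possibly for $\eta$ in a set of $\nu$-measure $0$; (iv) $f(\theta,\eta)=f(\eta,\theta)$ for all $\theta,\eta\in\Theta$. If the Markov chain on $\Theta$ with transition kernel $$T(d\theta\mid\eta)=\frac{f(\theta,\eta)}{\mathcal{T}(\eta)}\,R(d\theta\mid\eta)$$ is locally $\nu$-recurrent, then $\nu$ is strongly admissible with respect to $\Phi_f$; that is, for every $\varphi\in\Phi_f$ the formal Bayes estimator $\hat\varphi$ of $\varphi$ under the prior $\nu$ is almost-$\nu$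 admissible.
   Context: Setting. $\mathcal{X}$ (sample space) and $\Theta$ (parameter space) are Polish spaces with Borel $\sigma$-algebras $\mathcal{B}$ and $\mathcal{C}$. $\{P(\cdot\mid\theta):\theta\in\Theta\}$ is a family of probability measures on $(\mathcal{X},\mathcal{B})$ such that $P(B\mid\cdot)$ is $\mathcal{C}$-measurable for each $B\in\mathcal{B}$. The prior $\nu$ is a $\sigma$-finite measure on $(\Theta,\mathcal{C})$ with $\nu(\Theta)=\infty$, and the marginal $M(dx)=\int_\Theta P(dx\mid\theta)\,\nu(d\theta)$ is assumed $\sigma$-finite. The formal posterior $Q(d\theta\mid x)$ is a Markov kernel from $\mathcal{X}$ to $\Theta$ (a probability measure on $(\Theta,\mathcal C)$ for each $x$, measurable in $x$) satisfying the disintegration $Q(d\theta\mid x)\,M(dx)=P(dx\mid\theta)\,\nu(d\theta)$ as measures on $\mathcal{X}\times\Theta$. The expected posterior (Eaton kernel) is the Markov kernel on $\Theta$ $$R(d\theta\mid\eta)=\int_{\mathcal{X}}Q(d\theta\mid x)\,P(dx\mid\eta).$$ Estimation. For measurable $\varphi:\Theta\to\mathbb{R}^p$ ($p\ge1$), the formal Bayes estimator of $\varphi$ under squared error loss is the posterior mean $\hat\varphi(x)=\int_\Theta\varphi(\theta)\,Q(d\theta\mid x)$. The risk function of an estimator $\delta:\mathcal{X}\to\mathbb{R}^p$ of $\varphi(\theta)$ is $\mathsf{R}(\delta;\theta)=\int_{\mathcal{X}}\|\varphi(\theta)-\delta(x)\|^2\,P(dx\mid\theta)$, with $\|\cdot\|$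 the Euclidean norm. The estimator $\delta$ is almost-$\nu$ admissible if for every estimator $\delta_1$ with $\mathsf{R}(\delta_1;\theta)\le\mathsf{R}(\delta;\theta)$ for all $\theta\in\Theta$, the set $\{\theta:\mathsf{R}(\delta_1;\theta)<\mathsf{R}(\delta;\theta)\}$ has $\nu$-measure $0$. The class $\Phi_f$ consists of all measurable $\varphi:\Theta\to\mathbb{R}^p$ ($p\ge 1$) for which there is a constant $0<M_\varphi<\infty$ with $\|\varphi(\theta)-\varphi(\eta)\|^2\le M_\varphi f(\theta,\eta)$ for all $\theta,\eta\in\Theta$. Local recurrence. Let $\xi$ be a non-trivial $\sigma$-finite measure on the state space of a time-homogeneous Markov chain $W=(W_0,W_1,\dots)$. A measurable set $D$ is $\xi$-proper if $0<\xi(D)<\infty$. A $\xi$-proper set $D$ is locally $\xi$-recurrent if $\Pr(W_n\in D\text{ for some }n\ge1\mid W_0=w)=1$ for all $w\in D$ outside a $\xi$-null set. The chain is locally $\xi$-recurrent if every $\xi$-proper set is locally $\xi$-recurrent. *)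

(* Defs.v *)
From HB Require Import structures.
From mathcomp Require Import all_boot all_order all_algebra.
From mathcomp Require Import all_classical all_reals all_analysis.

Set Implicit Arguments.
Unset Strict Implicit.
Unset Printing Implicit Defensive.

Import Order.TTheory GRing.Theory Num.Theory.
Import numFieldNormedType.Exports.

Local Open Scope classical_set_scope.
Local Open Scope ring_scope.
Local Open Scope ereal_scope.

Notation borel T := (g_sigma_algebraType (@open T)).

Section polish.
Context (R : realType) (T : ptopologicalType).

Definition is_metric (dist : T -> T -> R) : Prop :=
  [/\ forall x y, (0 <= dist x y)%R,
      forall x y, dist x y = 0%R <-> x = y,
      forall x y, dist x y = dist y x
    & forall x y z, (dist x z <= dist x y + dist y z)%R].

Definition metrizes (dist : T -> T -> R) : Prop :=
  forall (x : T) (A : set T),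
    nbhs x A <-> exists2 e : R, (0 < e)%R & [set y | (dist x y < e)%R] `<=` A.

Definition complete_metric (dist : T -> T -> R) : Prop :=
  forall u : nat -> T,
    (forall e : R, (0 < e)%R -> exists N : nat, forall m n : nat,
        (N <= m)%N -> (N <= n)%N -> (dist (u m) (u n) < e)%R) ->
    exists l : T, u @ \oo --> l.

Definition polish : Prop :=
  (exists2 S : set T, countable S & dense S) /\
  (exists dist : T -> T -> R,
     [/\ is_metric dist, metrizes dist & complete_metric dist]).

End polish.

Section markov_chains.
Context (R : realType) (d dO : measure_display).
Context (S : measurableType d) (Omega : measurableType dO).

Definition history (W : nat -> Omega -> S) (n : nat) : set (set Omega) :=
  <<s \bigcup_(k in [set k | (k <= n)%N])
        preimage_set_system setT (W k) measurable >>.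

(* [Pr w] is the law Pr(. | W_0 = w). *)
Definition markov_chain (K : S -> set S -> \bar R)
    (Pr : S -> probability Omega R) (W : nat -> Omega -> S) : Prop :=
  [/\ forall n, measurable_fun setT (W n),
      forall w A, measurable A -> Pr w (W 0%N @^-1` A) = \d_w A
    & forall w n H A, history W n H -> measurable A ->
        Pr w (H `&` W n.+1 @^-1` A) = \int[Pr w]_(o in H) K (W n o) A].

Variable xi : {measure set S -> \bar R}.

Definition proper_set (D : set S) : Prop :=
  measurable D /\ 0 < xi D < +oo.

Definition locally_recurrent_set (Pr : S -> probability Omega R)
    (W : nat -> Omega -> S) (D : set S) : Prop :=
  {ae xi, forall w, D w ->
     Pr w [set o | exists2 n : nat, (1 <= n)%N & D (W n o)] = 1}.

Definition locally_recurrent (Pr : S -> probability Omega R)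
    (W : nat -> Omega -> S) : Prop :=
  forall D, proper_set D -> locally_recurrent_set Pr W D.

End markov_chains.

Definition integrable_exhaustion (R : realType) (d : measure_display)
    (T : measurableType d) (nu : {measure set T -> \bar R}) (h : T -> \bar R)
    : Prop :=
  exists K : nat -> set T,
    [/\ forall i, measurable (K i),
        forall i, K i `<=` K i.+1,
        \bigcup_i K i = setT
      & forall i, 0 < nu (K i) < +oo /\ \int[nu]_(t in K i) h t < +oo].

Section bayes.
Context (R : realType) (dX dT : measure_display).
Context (X : measurableType dX) (Theta : measurableType dT).

Section marginal.
Variables (P : R.-pker Theta ~> X) (nu : {measure set Theta -> \bar R}).

Definition marginal (B : set X) : \bar R := \int[nu]_t P t B.

Let marginal0 : marginal set0 = 0.
Proof. by apply: integral0_eq => t _; rewrite measure0. Qed.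

Let marginal_ge0 B : 0 <= marginal B.
Proof. by apply: integral_ge0 => t _; exact: measure_ge0. Qed.

Let marginal_additive : semi_sigma_additive marginal.
Proof.
move=> F mF tF mUF; rewrite [X in _ --> X](_ : _ =
  \int[nu]_t (\sum_(n <oo) P t (F n))); last first.
  apply: eq_integral => t _.
  by apply/esym/cvg_lim => //; exact/measure_semi_sigma_additive.
apply/cvg_closeP; split.
  by apply: is_cvg_nneseries => n _ _; exact: integral_ge0.
rewrite closeE// integral_nneseries// => n.
exact: measurable_kernel.
Qed.

HB.instance Definition _ := isMeasure.Build _ _ _ marginal
  marginal0 marginal_ge0 marginal_additive.

End marginal.

Variables (P : R.-pker Theta ~> X) (Q : R.-pker X ~> Theta).
Variable nu : {measure set Theta -> \bar R}.

(* Q(dt|x) M(dx) = P(dx|t) nu(dt) as measures on X * Theta. *)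
Definition formal_posterior : Prop :=
  forall C : set (X * Theta), measurable C ->
    \int[marginal P nu]_x Q x (xsection C x) =
    \int[nu]_t P t (ysection C t).

(* R(A|eta) = \int Q(A|x) P(dx|eta) *)
Definition expected_posterior : Theta -> {measure set Theta -> \bar R} :=
  mkcomp_noparam P Q.

Variable f : Theta * Theta -> R.

Definition Tnorm (eta : Theta) : \bar R :=
  \int[expected_posterior eta]_t (f (t, eta))%:E.

(* T(dt|eta) = f(t,eta) / Tnorm(eta) R(dt|eta), meaningful only when
   0 < Tnorm(eta) < +oo, since [fine] sends +oo to 0. *)
Definition transition_kernel (eta : Theta) (A : set Theta) : \bar R :=
  \int[expected_posterior eta]_(t in A) (f (t, eta) / fine (Tnorm eta))%:E.

Definition enorm (p : nat) (v : 'rV[R]_p) : R :=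
  Num.sqrt (\sum_(i < p) v ord0 i ^+ 2)%R.

(* Measurability for the Borel sigma-algebra of R^p, which is the product one. *)
Definition measurable_vec (d : measure_display) (S : measurableType d)
    (p : nat) (g : S -> 'rV[R]_p) : Prop :=
  forall i : 'I_p, measurable_fun setT (fun s => g s ord0 i).

Definition Phi (p : nat) (phi : Theta -> 'rV[R]_p) : Prop :=
  measurable_vec phi /\
  exists2 M : R, (0 < M)%R &
    forall t eta, (enorm (phi t - phi eta) ^+ 2 <= M * f (t, eta))%R.

(* The integral is a junk value where phi is not Q(.|x)-integrable.  If phi is
   in Phi and Tnorm is finite everywhere, then for every t these x form a
   P(.|t)-null set, so they do not affect the risk. *)
Definition posterior_mean (p : nat) (phi : Theta -> 'rV[R]_p) (x : X)
    : 'rV[R]_p :=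
  (\row_(i < p) \int[Q x]_t (phi t ord0 i))%R.

Definition risk (p : nat) (phi : Theta -> 'rV[R]_p) (delta : X -> 'rV[R]_p)
    (t : Theta) : \bar R :=
  \int[P t]_x (enorm (phi t - delta x) ^+ 2)%:E.

Definition almost_admissible (p : nat) (phi : Theta -> 'rV[R]_p)
    (delta : X -> 'rV[R]_p) : Prop :=
  forall delta1 : X -> 'rV[R]_p, measurable_vec delta1 ->
    (forall t, risk phi delta1 t <= risk phi delta t) ->
    nu [set t | risk phi delta1 t < risk phi delta t] = 0.

Definition strongly_admissible : Prop :=
  forall (p : nat) (phi : Theta -> 'rV[R]_p), (1 <= p)%N -> Phi phi ->
    almost_admissible phi (posterior_mean phi).

End bayes.

(* Main.v *)
Require Import Defs.
From HB Require Import structures.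
From mathcomp Require Import all_boot all_order all_algebra.
From mathcomp Require Import all_classical all_reals all_analysis.
From mathcomp Require Import measurable_realfun.
From mathcomp Require Import ring lra.

(** Why the theorem holds.  Put [tau eta = Tnorm eta].  The disintegration
    of the joint law says that drawing [eta] from [nu], then [x] from
    [P(.|eta)], then [t] from [Q(.|x)] is the same as drawing [x] from the
    marginal [M] and then [t] and [eta] independently from [Q(.|x)].  Hence
    [R(dt|eta) nu(deta)] is a symmetric measure, and since [f] is symmetric the
    chain with kernel [T(dt|eta) = f(t,eta)/tau(eta) R(dt|eta)] is reversible
    with respect to [tau * nu].  Its Dirichlet form is, up to a factor two,
    [energy g], the integral of [f(t,eta) (g t - g eta)^2] against that
    symmetric measure.

    Statistics: a function [g] with values in [0,1] is used as a prior density
    [g^2] with respect to [nu], as in Blyth's method.  For fixed [x], the excess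
    posterior loss of the estimator [phihat] over any competitor, weighted by
    [g^2], is at most the double [Q(.|x)]-integral of
    [(phi t - phi s)^2 (g t - g s)^2] ([posterior_regret_le]).  Integrating in
    [x] and using [|phi t - phi s|^2 <= C f(t,s)], the integrated excess risk is
    at most [C * energy g] ([bayes_regret_le]).

    Probability: recurrence produces functions of arbitrarily small energy that
    equal one on a given set [D] and vanish off a set of finite [tau * nu]
    measure ([recurrent_low_energy]).  They are the probabilities [h_n] of
    hitting [D] within [n] steps while staying inside an exhaustion [E_n].
    Each [h_n] is subharmonic off [D] where it is positive, which bounds its
    energy by twice the integral of [1 - T h_n] over [D] against [tau * nu]
    ([energy_le]).  The limit of the [h_n] is superharmonic off [D], so [T]
    applied to it dominates the probability of returning to [D]
    ([hitting_le_superharmonic]), which is one almost everywhere on [D]; by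
    monotone convergence the energies tend to zero.

    If a competitor [delta] is never worse than [phihat], these two halves show
    that the integrals of both risks over each [D] of an exhaustion of [Theta]
    are equal, hence that the risks agree [nu]-almost everywhere
    ([posterior_mean_admissible]).

    Measure theory: every change of the order of integration above compares two
    operations on nonnegative measurable functions that are additive,
    homogeneous and continuous along increasing sequences.  Such operations are
    called [int_op] here; they compose, and two of them coincide as soon as they
    agree on indicators ([int_op_ext]). *)

Set Implicit Arguments.
Unset Strict Implicit.
Unset Printing Implicit Defensive.

Import Order.TTheory GRing.Theory Num.Theory.
Import numFieldNormedType.Exports.

Local Open Scope classical_set_scope.
Local Open Scope ring_scope.
Local Open Scope ereal_scope.

(** * Nonnegative measurable functions and integral operators *)
Definition nnmeas (R : realType) (d : measure_display) (T : measurableType d)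
  (g : T -> \bar R) : Prop := (forall t, 0 <= g t) /\ measurable_fun setT g.

Section nnmeas_theory.
Context (R : realType) (d d' : measure_display).
Context (S : measurableType d) (T : measurableType d').
Implicit Types g h : T -> \bar R.

Lemma nnmeas_indic (A : set T) :
  measurable A -> nnmeas (fun t => (\1_A t)%:E : \bar R).
Proof.
move=> mA; split=> [t|]; first by rewrite lee_fin.
by apply/measurable_EFinP; exact: measurable_indic.
Qed.

Lemma nnmeas_cst (r : R) : (0 <= r)%R -> nnmeas (fun _ : T => r%:E).
Proof. by move=> r0; split=> [t|]; [rewrite lee_fin|exact: measurable_cst]. Qed.

Lemma nnmeasD g h : nnmeas g -> nnmeas h -> nnmeas (fun t => g t + h t).
Proof.
move=> [g0 mg] [h0 mh]; split=> [t|]; first exact: adde_ge0.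
exact: emeasurable_funD.
Qed.

Lemma nnmeasM g h : nnmeas g -> nnmeas h -> nnmeas (fun t => g t * h t).
Proof.
move=> [g0 mg] [h0 mh]; split=> [t|]; first exact: mule_ge0.
exact: emeasurable_funM.
Qed.

Lemma nnmeas_comp (u : S -> T) g :
  measurable_fun setT u -> nnmeas g -> nnmeas (fun s => g (u s)).
Proof.
by move=> mu [g0 mg]; split=> [s|]; [exact: g0|exact: measurableT_comp mg mu].
Qed.

Lemma nnmeas_lim (g_ : nat -> T -> \bar R) : (forall n, nnmeas (g_ n)) ->
  (forall t, nondecreasing_seq (g_ ^~ t)) -> nnmeas (fun t => limn (g_ ^~ t)).
Proof.
move=> g_nn g_nd; split=> [t|].
  apply: lime_ge; first exact: ereal_nondecreasing_is_cvgn.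
  by apply: nearW => n; exact: (g_nn n).1.
apply: (emeasurable_fun_cvg g_) => [n|t _]; first exact: (g_nn n).2.
exact: ereal_nondecreasing_is_cvgn.
Qed.

End nnmeas_theory.

Section nnmeas_integral.
Context (R : realType) (d : measure_display) (T : measurableType d).
Variables (mu : {measure set T -> \bar R}) (D : set T).
Hypothesis mD : measurable D.
Implicit Types g h : T -> \bar R.

Lemma nn_integral_ge0 g : nnmeas g -> 0 <= \int[mu]_(t in D) g t.
Proof. by move=> gn; apply: integral_ge0 => t _; exact: gn.1. Qed.

Lemma nn_integral_le g h : nnmeas g -> nnmeas h ->
  (forall t, D t -> g t <= h t) ->
  \int[mu]_(t in D) g t <= \int[mu]_(t in D) h t.
Proof.
move=> gn hn gh; apply: ge0_le_integral => //.
- by move=> t _; exact: gn.1.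
- exact: measurable_funTS gn.2.
- exact: measurable_funTS hn.2.
Qed.

Lemma nn_integralD g h : nnmeas g -> nnmeas h ->
  \int[mu]_(t in D) (g t + h t) =
  \int[mu]_(t in D) g t + \int[mu]_(t in D) h t.
Proof.
move=> gn hn; apply: ge0_integralD => //.
- by move=> t _; exact: gn.1.
- exact: measurable_funTS gn.2.
- by move=> t _; exact: hn.1.
- exact: measurable_funTS hn.2.
Qed.

Lemma nn_integralZ (r : R) g : (0 <= r)%R -> nnmeas g ->
  \int[mu]_(t in D) (r%:E * g t) = r%:E * \int[mu]_(t in D) g t.
Proof.
move=> r0 gn; apply: ge0_integralZl_EFin => //.
- by move=> t _; exact: gn.1.
- exact: measurable_funTS gn.2.
Qed.

Lemma integral_indicM g :
  \int[mu]_(t in D) g t = \int[mu]_t ((\1_D t)%:E * g t).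
Proof.
rewrite integral_mkcond; apply: eq_integral => t _.
by rewrite patchE indicE; case: (t \in D); rewrite ?mul1e ?mul0e.
Qed.

End nnmeas_integral.

(** These are the operations [g |-> (s |-> integral of g against m_s)] for a
    family of measures [m_s], described by the axioms of an integral so that
    no measure has to be constructed to compose them.  With [S] a one-point
    space they are the integrals themselves. *)
Record int_op (R : realType) (d d' : measure_display)
    (S : measurableType d) (T : measurableType d')
    (L : (T -> \bar R) -> S -> \bar R) : Prop := IntOp {
  iop_nn : forall g, nnmeas g -> nnmeas (L g) ;
  iop_le : forall g h, nnmeas g -> nnmeas h ->
    (forall t, g t <= h t) -> forall s, L g s <= L h s ;
  iopD : forall g h, nnmeas g -> nnmeas h ->
    forall s, L (fun t => g t + h t) s = L g s + L h s ;
  iopZ : forall (r : R) g, (0 <= r)%R -> nnmeas g ->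
    forall s, L (fun t => r%:E * g t) s = r%:E * L g s ;
  iop_lim : forall g_ : nat -> T -> \bar R, (forall n, nnmeas (g_ n)) ->
    (forall t, nondecreasing_seq (g_ ^~ t)) ->
    forall s, L (fun t => limn (g_ ^~ t)) s = limn (fun n => L (g_ n) s) }.

Section int_op_extensionality.
Context (R : realType) (d d' : measure_display).
Context (S : measurableType d) (T : measurableType d').
Implicit Types L : (T -> \bar R) -> S -> \bar R.

Lemma iop_sum L (I : Type) (r : seq I) (g : I -> T -> \bar R) : int_op L ->
  (forall i, nnmeas (g i)) -> nnmeas (fun t => \sum_(i <- r) g i t) /\
  forall s, L (fun t => \sum_(i <- r) g i t) s = \sum_(i <- r) L (g i) s.
Proof.
move=> Lop gnn; elim: r => [|i r [IH1 IH2]].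
  split=> [|s]; last first.
    rewrite big_nil (_ : (fun _ => _) = (fun t => 0%:E * (cst 0 t)))//.
      by rewrite (iopZ Lop)// ?mul0e//; exact: nnmeas_cst.
    by apply/funext => t; rewrite big_nil mule0.
  rewrite (_ : (fun _ => _) = (cst 0%:E)); first exact: nnmeas_cst.
  by apply/funext => t; rewrite big_nil.
have -> : (fun t => \sum_(j <- i :: r) g j t) =
          (fun t => g i t + \sum_(j <- r) g j t).
  by apply/funext => t; rewrite big_cons.
split=> [|s]; first exact: nnmeasD.
by rewrite (iopD Lop)// big_cons IH2.
Qed.

Import HBNNSimple.

(** The monotone class argument for functions, made once for all: simple
    functions approximate [g] from below. *)
Lemma int_op_ext L1 L2 : int_op L1 -> int_op L2 ->
  (forall A, measurable A ->
     L1 (fun t => (\1_A t)%:E) = L2 (fun t => (\1_A t)%:E)) ->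
  forall g, nnmeas g -> L1 g = L2 g.
Proof.
move=> op1 op2 L12 g [g0 mg]; apply/funext => s.
pose g_ := nnsfun_approx measurableT mg.
pose e_ n t := (g_ n t)%:E : \bar R.
have e_nn n : nnmeas (e_ n).
  by split=> [t|]; [rewrite lee_fin|exact/measurable_EFinP].
have e_nd t : nondecreasing_seq (e_ ^~ t).
  by move=> a b ab; rewrite lee_fin; exact/lefP/nd_nnsfun_approx.
have -> : g = (fun t => limn (e_ ^~ t)).
  by apply/funext => t; apply/esym/cvg_lim => //; exact: cvg_nnsfun_approx.
rewrite (iop_lim op1)// (iop_lim op2)//; congr (limn _); apply/funext => n.
(* The maximum only makes the summands nonnegative for every real [r]; the
   values taken by [g_ n] are already nonnegative. *)
pose c_ (r : R) t := (Num.max 0 r)%:E * (\1_(g_ n @^-1` [set r]) t)%:E : \bar R.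
have c_nn r : nnmeas (c_ r).
  by apply: nnmeasM; [apply: nnmeas_cst; rewrite le_max lexx|exact: nnmeas_indic].
have -> : e_ n = (fun t => \sum_(r <- finmap.enum_fset (fset_set (range (g_ n)))) c_ r t).
  apply/funext => t; rewrite /e_ fimfunE -fsumEFin//= fsbig_finite//=.
  rewrite big_seq [RHS]big_seq; apply: eq_bigr => r.
  rewrite in_fset_set// inE => -[u _ <-].
  by rewrite /c_ EFinM max_r.
rewrite (iop_sum _ op1 c_nn).2 (iop_sum _ op2 c_nn).2.
apply: eq_bigr => r _; rewrite (iopZ op1) ?(iopZ op2) ?le_max ?lexx//.
- by rewrite L12.
- exact: nnmeas_indic.
- exact: nnmeas_indic.
Qed.

End int_op_extensionality.

Section int_op_examples.
Context (R : realType) (d d' d'' : measure_display).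
Context (S : measurableType d) (T : measurableType d') (U : measurableType d'').

Lemma int_op_comp (L : (T -> \bar R) -> S -> \bar R)
    (L' : (U -> \bar R) -> T -> \bar R) :
  int_op L -> int_op L' -> int_op (fun g => L (L' g)).
Proof.
move=> op op'; split.
- by move=> g /(iop_nn op')/(iop_nn op).
- by move=> g h gn hn gh s; apply: (iop_le op); [exact: iop_nn..|exact: iop_le].
- move=> g h gn hn s; rewrite -(iopD op); [|exact: iop_nn..].
  by congr (L _ s); apply/funext => t; rewrite (iopD op').
- move=> r g r0 gn s; rewrite -(iopZ op)//; last exact: iop_nn.
  by congr (L _ s); apply/funext => t; rewrite (iopZ op').
- move=> g_ gn gnd s; rewrite -(iop_lim op).
  + by congr (L _ s); apply/funext => t; rewrite (iop_lim op').
  + by move=> n; exact: iop_nn.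
  + move=> t a b ab; apply: (iop_le op') => //.
    by move=> u; exact: gnd.
Qed.

Lemma int_op_precomp (u : S -> T) : measurable_fun setT u ->
  int_op (fun (g : T -> \bar R) s => g (u s)).
Proof. by move=> mu; split=> //; move=> g gn; exact: nnmeas_comp. Qed.

Lemma int_op_mul (w : T -> \bar R) : nnmeas w ->
  (forall t, w t \is a fin_num) -> int_op (fun g t => w t * g t).
Proof.
move=> wn wfin; split.
- by move=> g gn; exact: nnmeasM.
- by move=> g h _ _ gh t; apply: lee_wpmul2l; [exact: wn.1|exact: gh].
- by move=> g h [g0 _] [h0 _] t; rewrite ge0_muleDr.
- by move=> r g _ _ t; rewrite muleCA.
- by move=> g_ gn gnd t; rewrite limeMl//; exact: ereal_nondecreasing_is_cvgn.
Qed.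

Lemma int_op_integral (mu : {measure set T -> \bar R}) (D : set T) :
  measurable D -> int_op (fun g (_ : S) => \int[mu]_(t in D) g t).
Proof.
move=> mD; split.
- by move=> g gn; split=> [_|//]; exact: nn_integral_ge0.
- by move=> g h gn hn gh _; exact: nn_integral_le.
- by move=> g h gn hn _; exact: nn_integralD.
- by move=> r g r0 gn _; exact: nn_integralZ.
- move=> g_ gn gnd _; apply: monotone_convergence => //.
  + by move=> n; exact: measurable_funTS (gn n).2.
  + by move=> n t _; exact: (gn n).1.
Qed.

Lemma int_op_kernel (k : R.-sfker S ~> T) :
  int_op (fun (g : S * T -> \bar R) s => \int[k s]_t g (s, t)).
Proof.
have section_nn (g : S * T -> \bar R) s : nnmeas g -> nnmeas (fun t => g (s, t)).
  by apply: nnmeas_comp; exact: pair1_measurable.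
split.
- move=> g [g0 mg]; split=> [s|]; first exact: integral_ge0.
  exact: measurable_fun_integral_sfinite_kernel.
- by move=> g h gn hn gh s; apply: nn_integral_le => //; exact: section_nn.
- by move=> g h gn hn s; apply: nn_integralD => //; exact: section_nn.
- by move=> r g r0 gn s; apply: nn_integralZ => //; exact: section_nn.
- move=> g_ gn gnd s; apply: monotone_convergence => //.
  + by move=> n; exact: (section_nn _ s (gn n)).2.
  + by move=> n t _; exact: (gn n).1.
Qed.

End int_op_examples.

(** * The symmetric measure of a formal posterior *)
Section posterior_integrals.
Context (R : realType) (dX dT : measure_display).
Context (X : measurableType dX) (Theta : measurableType dT).
Variables (P : R.-pker Theta ~> X) (Q : R.-pker X ~> Theta).
Variable nu : {measure set Theta -> \bar R}.

Local Notation M := (marginal P nu).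

Lemma integral_expected_posterior (g : Theta -> \bar R) (e : Theta) : nnmeas g ->
  \int[expected_posterior P Q e]_t g t = \int[P e]_x \int[Q x]_t g t.
Proof.
pose opR := int_op_comp (int_op_kernel (mkcomp_noparam P Q))
  (int_op_precomp R (@measurable_snd _ _ Theta Theta)).
have opQ := int_op_comp (int_op_kernel Q)
  (int_op_precomp R (@measurable_snd _ _ X Theta)).
have opPQ := int_op_comp (int_op_comp (int_op_kernel P)
  (int_op_precomp R (@measurable_snd _ _ Theta X))) opQ.
move=> gn; apply: (congr1 (@^~ e) (int_op_ext opR opPQ _ gn)) => A mA.
apply/funext => {}e; rewrite integral_indic// setIT.
by apply: eq_integral => x _; rewrite integral_indic// setIT.
Qed.

Hypothesis Q_posterior : formal_posterior P Q nu.

(** The disintegration, extended from measurable sets to functions. *)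
Lemma integral_posterior (g : X * Theta -> \bar R) : nnmeas g ->
  \int[M]_x \int[Q x]_t g (x, t) = \int[nu]_t \int[P t]_x g (x, t).
Proof.
have opMQ := int_op_comp (@int_op_integral R _ _ unit X M setT measurableT)
  (int_op_kernel Q).
have opP := int_op_comp (@int_op_integral R _ _ unit Theta nu setT measurableT)
  (int_op_comp (int_op_kernel P)
     (int_op_precomp R (@measurable_swap _ _ Theta X))).
move=> gn; apply: (congr1 (@^~ tt) (int_op_ext opMQ opP _ gn)) => A mA.
apply/funext => _.
rewrite (_ : \int[M]_x _ = \int[M]_x Q x (xsection A x)).
  rewrite Q_posterior//; apply: eq_integral => t _.
  rewrite -[ysection A t]setIT -integral_indic//; last exact: measurable_ysection.
  by apply: eq_integral => x _ /=; rewrite !indicE /= mem_ysection.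
apply: eq_integral => x _.
rewrite -[xsection A x]setIT -integral_indic//; last exact: measurable_xsection.
by apply: eq_integral => t _ /=; rewrite !indicE /= mem_xsection.
Qed.

(** Integral against the law of two independent draws from the posterior at a
    common [x] distributed as the marginal: the form of the measure
    [R(dt|e) nu(de)] in which its symmetry is visible. *)
Definition pair_integral (F : Theta * Theta -> \bar R) : \bar R :=
  \int[M]_x \int[Q x]_e \int[Q x]_t F (t, e).

(** Measurability in the pair [(x, e)] jointly comes from viewing [Q] as a
    kernel on [Theta * X] that ignores its first argument. *)
Lemma int_op_posterior_section :
  int_op (fun (F : Theta * Theta -> \bar R) (z : X * Theta) =>
    \int[Q z.1]_t F (t, z.2)).
Proof.
have mu : measurable_fun setT (fun z : (Theta * X) * Theta => (z.2, z.1.1)).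
  apply: measurable_fun_pair => //=.
  exact: measurableT_comp measurable_fst measurable_fst.
exact: (int_op_comp (int_op_precomp R (@measurable_swap _ _ X Theta))
  (int_op_comp (int_op_kernel (kernel.kernel_snd (T0 := Theta) Q))
    (int_op_precomp R mu))).
Qed.

Lemma int_op_posterior_pair :
  int_op (fun (F : Theta * Theta -> \bar R) x =>
    \int[Q x]_e \int[Q x]_t F (t, e)).
Proof. exact: (int_op_comp (int_op_kernel Q) int_op_posterior_section). Qed.

Lemma pair_integralE F : nnmeas F ->
  pair_integral F = \int[nu]_e \int[expected_posterior P Q e]_t F (t, e).
Proof.
move=> Fn; have := integral_posterior (iop_nn int_op_posterior_section Fn).
rewrite /pair_integral /= => ->; apply: eq_integral => e _.
rewrite integral_expected_posterior//.
apply: (nnmeas_comp (u := fun t => (t, e))) => //; exact: pair2_measurable.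
Qed.

(** For fixed [x] this is Tonelli for the product of [Q(.|x)] with itself. *)
Lemma pair_integral_swap F : nnmeas F ->
  pair_integral F = pair_integral (fun z => F (z.2, z.1)).
Proof.
move=> [F0 mF]; apply: eq_integral => x _.
pose q := HB.pack_for (SFiniteMeasure.type Theta R) (Measure.sort (Q x))
  (isSFinite.Build _ _ _ _ (sfinite_kernel_measure Q x)).
exact: (@sfinite_Fubini _ _ _ _ R q q (fun z => F (z.2, z.1)) (fun z => F0 _)
  (measurableT_comp mF (@measurable_swap _ _ Theta Theta))).
Qed.

End posterior_integrals.

(** * Superharmonic functions dominate hitting probabilities *)
Section hitting_probability.
Context (R : realType) (d dO : measure_display).
Context (S : measurableType d) (Omega : measurableType dO).
Variables (K : S -> set S -> \bar R) (Pr : S -> probability Omega R).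
Variables (W : nat -> Omega -> S) (L : (S -> \bar R) -> S -> \bar R).
Hypothesis W_chain : markov_chain K Pr W.
Hypothesis L_op : int_op L.
Hypothesis L_indic : forall A e, measurable A ->
  L (fun t => (\1_A t)%:E) e = K e A.

Let mW n : measurable_fun setT (W n). Proof. by have [] := W_chain. Qed.

Lemma measurable_history n H : history W n H -> measurable H.
Proof.
apply: smallest_sub; first exact: sigma_algebra_measurable.
move=> _ [k _ [A mA <-]]; exact: mW.
Qed.

Lemma history_le m n : (m <= n)%N -> history W m `<=` history W n.
Proof.
move=> mn; apply: sub_smallest2r; first exact: smallest_sigma_algebra.
by move=> A [k km kA]; exists k => //=; exact: leq_trans km mn.
Qed.

Lemma integral_chain0 (g : S -> \bar R) w : nnmeas g ->
  \int[Pr w]_o g (W 0%N o) = g w.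
Proof.
have op0 := int_op_comp (@int_op_integral R _ _ unit Omega (Pr w) setT measurableT)
  (int_op_precomp R (mW 0)).
have opw := @int_op_precomp R _ _ unit S _ (@measurable_cst _ _ unit S setT w).
move=> gn; apply: (congr1 (@^~ tt) (int_op_ext op0 opw _ gn)) => A mA.
apply/funext => -[] /=; have [_ law0 _] := W_chain.
have := law0 w A mA; rewrite diracE indicE => <-.
rewrite -[X in Pr w X]setIT -integral_indic//.
by rewrite -[X in measurable X]setTI; exact: mW.
Qed.

(** The Markov property for functions of the next state. *)
Lemma integral_chainS (g : S -> \bar R) w n H : nnmeas g -> history W n H ->
  \int[Pr w]_(o in H) g (W n.+1 o) = \int[Pr w]_(o in H) L g (W n o).
Proof.
move=> gn nH; have mH := measurable_history nH.
have opH := @int_op_integral R _ _ unit Omega (Pr w) H mH.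
have op1 := int_op_comp opH (int_op_precomp R (mW n.+1)).
have op2 := int_op_comp opH (int_op_comp (int_op_precomp R (mW n)) L_op).
apply: (congr1 (@^~ tt) (int_op_ext op1 op2 _ gn)) => A mA.
apply/funext => _; have [_ _ lawS] := W_chain.
under [RHS]eq_integral do rewrite L_indic//.
rewrite -lawS//.
by rewrite setIC -integral_indic// -[X in measurable X]setTI; exact: mW.
Qed.

Let avoids (D : set S) n : set Omega :=
  [set o | forall k, (1 <= k <= n)%N -> ~ D (W k o)].

Let avoidsS D n : avoids D n.+1 = avoids D n `\` (W n.+1 @^-1` D).
Proof.
apply/seteqP; split => o.
  move=> oD; split; last by apply: oD; rewrite ltnSn.
  by move=> k /andP[k1 kn]; apply: oD; rewrite k1 leqW.
move=> [oD nD] k /andP[k1]; rewrite leq_eqVlt => /predU1P[->//|kn].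
by apply: oD; rewrite k1.
Qed.

Let history_avoids D n : measurable D -> history W n (avoids D n).
Proof.
move=> mD; elim: n => [|n IH].
  have -> : avoids D 0 = setT.
    by apply/seteqP; split => // o _ k; rewrite leqn0; case: k.
  exact: (@measurableT _ (g_sigma_algebraType _)).
rewrite avoidsS; apply: (@measurableD _ (g_sigma_algebraType _)).
  exact: history_le IH.
by apply: sub_sigma_algebra; exists n.+1 => //=; exists D => //; rewrite setTI.
Qed.

(** Up to the first visit to [D] at a positive time, [h (W_n)] is a
    supermartingale started, after one step, from [L h w]; at that visit it is
    at least one.  Stopping at time [n] gives the bound for the probability of a
    visit before [n]. *)
Lemma hitting_le_superharmonic (D : set S) (h : S -> \bar R) w :
  measurable D -> nnmeas h -> (forall e, D e -> 1 <= h e) ->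
  (forall e, ~ D e -> L h e <= h e) ->
  Pr w [set o | exists2 n, (1 <= n)%N & D (W n o)] <= L h w.
Proof.
move=> mD hn hD hND.
have Lhn := iop_nn L_op hn.
have mA n : measurable (avoids D n) by apply: measurable_history; exact: history_avoids.
have mgW (g : S -> \bar R) n A : nnmeas g -> measurable_fun A (fun o => g (W n o)).
  by move=> gn; apply: measurable_funTS; exact: measurableT_comp gn.2 (mW n).
(* The event [avoids D n] says that [D] is not visited at times 1 to [n]; on it
   one more step is taken, and the mass that enters [D] is paid for by
   [h >= 1]. *)
have key n : Pr w (~` avoids D n) + \int[Pr w]_(o in avoids D n) L h (W n o)
    <= L h w.
  elim: n => [|n IH].
    have -> : avoids D 0 = setT.
      by apply/seteqP; split => // o _ k; rewrite leqn0; case: k.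
    by rewrite setCT measure0 add0e integral_chain0.
  apply: le_trans IH.
  have -> : \int[Pr w]_(o in avoids D n) L h (W n o) =
      \int[Pr w]_(o in avoids D n.+1) h (W n.+1 o) +
      \int[Pr w]_(o in avoids D n `\` avoids D n.+1) h (W n.+1 o).
    rewrite -(integral_chainS w hn (@history_avoids D n mD)) -ge0_integral_setU//.
    - by rewrite setDUK// avoidsS; exact: subDsetl.
    - exact: measurableD.
    - exact: mgW.
    - by move=> o _; exact: hn.1.
    - by apply/disj_setPS => o [oA []].
  rewrite [leLHS]addeC [leRHS]addeCA; apply: leeD.
    apply: ge0_le_integral => //; [by move=> o _; exact: Lhn.1|exact: mgW..|].
    by move=> o oA; apply: hND; apply: oA; rewrite ltnSn.
  have -> : ~` avoids D n.+1 = ~` avoids D n `|` (avoids D n `\` avoids D n.+1).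
    rewrite avoidsS; apply/seteqP; split=> o /=.
      have [oA|] := pselect (avoids D n o); last by left.
      by move=> /not_andP[//|/contrapT oD]; right; split=> // -[].
    by move=> [oA [//]|[oA nA]].
  rewrite measureU//; [|exact: measurableC|exact: measurableD|]; last first.
    by apply/seteqP; split=> // o [/= ? [? _]].
  apply: leeD => //.
  rewrite -[leLHS]mul1e -integral_cst//; last exact: measurableD.
  apply: ge0_le_integral => //; [exact: measurableD|exact: mgW|].
  move=> o [oA]; rewrite avoidsS => /not_andP[//|/contrapT oD].
  exact: hD.
have -> : [set o | exists2 n, (1 <= n)%N & D (W n o)] =
    \bigcup_n ~` avoids D n.
  apply/seteqP; split => o.
    move=> [n n1 nD]; exists n => //= /(_ n).
    by rewrite n1 leqnn => /(_ isT).
  move=> [n _ /existsNP[k /not_implyP[/andP[k1 _] /contrapT kD]]].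
  by exists k.
have nd : nondecreasing_seq (fun n => ~` avoids D n).
  move=> m n mn; apply/subsetPset; apply: subsetC => o oA k /andP[k1 km].
  by apply: oA; rewrite k1 (leq_trans km).
have cvg : Pr w (~` avoids D n) @[n --> \oo] --> Pr w (\bigcup_n ~` avoids D n).
  apply: nondecreasing_cvg_mu => //.
    by move=> n; exact: measurableC.
  by apply: bigcup_measurable => n _; exact: measurableC.
rewrite -(cvg_lim _ cvg)//; apply: lime_le; first by apply/cvg_ex; eexists; exact: cvg.
apply: nearW => n; apply: le_trans (key n); rewrite leeDl//.
by apply: integral_ge0 => o _; exact: Lhn.1.
Qed.

End hitting_probability.

(** * Posterior loss at a fixed observation *)
Section posterior_covariance.
Context (R : realType) (dX d : measure_display).
Context (X : measurableType dX) (T : measurableType d).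
Variables (Q : R.-pker X ~> T) (x : X).

Local Notation q := (Q x).

Local Notation rint h := (q.-integrable setT (EFin \o (h : T -> R))).

Let rint_cst (c : R) : rint (cst c).
Proof.
apply: measurable_bounded_integrable => //; first by rewrite prob_kernel ltry.
by exists `|c|%R; split=> // r cr y _ /=; exact: ltW.
Qed.

Let Rint_cst (c : R) : (\int[q]_(t in setT) c)%R = c.
Proof. by rewrite Rintegral_cst// prob_kernel mulr1. Qed.

Let rintD (h k : T -> R) : rint h -> rint k -> rint (fun t => h t + k t)%R.
Proof. by move=> hi ki; exact: (integrableD measurableT hi ki). Qed.

Let rintZ (c : R) (h : T -> R) : rint h -> rint (fun t => c * h t)%R.
Proof. by move=> hi; exact: (integrableZl measurableT c hi). Qed.

Lemma Rintegral_le_ge0 (h : T -> R) (G : T -> \bar R) : rint h -> nnmeas G ->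
  (forall t, (h t)%:E <= G t) -> (\int[q]_t h t)%:E <= \int[q]_t G t.
Proof.
move=> hi [G0 mG] hG; rewrite fineK; last exact: integrable_fin_num.
apply: (@le_trans _ _ (\int[q]_t (EFin \o h)^\+ t)).
  rewrite integralE; apply: geeDl; rewrite oppe_le0; exact: integral_ge0.
apply: ge0_le_integral => //.
- exact: measurable_funepos (measurable_int _ hi).
- by move=> t _; rewrite funeposE /= ge_max hG G0.
Qed.

Variables (phi g : T -> R).
Hypothesis phi_int : rint phi.
Hypothesis mg : measurable_fun setT g.
Hypothesis g01 : forall t, (0 <= g t <= 1)%R.

Let a : R := (\int[q]_t phi t)%R.

Let mphi : measurable_fun setT phi.
Proof. by apply/measurable_EFinP; exact: measurable_int phi_int. Qed.

(** With [u = b - a], the difference of the two weighted losses is the integral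
    of [k = g^2 (2 u (phi - a) - u^2)].  As [phi - a] has mean zero, twice this
    integral is unchanged when [2 u (phi t - a) (g s)^2] and its mirror image
    are subtracted, which leaves the integrand
    [2 u (phi t - phi s) ((g t)^2 - (g s)^2) - u^2 ((g t)^2 + (g s)^2)]; by the
    arithmetic-geometric mean inequality it is at most
    [2 (phi t - phi s)^2 (g t - g s)^2].  The inequality is integrated first in
    [t], then in [s]. *)
Lemma posterior_regret_le (b : R) :
  \int[q]_t (g t ^+ 2 * (phi t - a) ^+ 2)%:E <=
  \int[q]_t (g t ^+ 2 * (phi t - b) ^+ 2)%:E +
  \int[q]_s \int[q]_t ((phi t - phi s) ^+ 2 * (g t - g s) ^+ 2)%:E.
Proof.
set u := (b - a)%R.
pose al t := (phi t - a)%R.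
pose w t := (g t ^+ 2)%R.
pose k t := (w t * (2 * u * al t - u ^+ 2))%R.
have w01 t : (0 <= w t <= 1)%R.
  by have /andP[g0 g1] := g01 t; rewrite sqr_ge0 exprn_ile1.
have ali : rint al by apply: rintD => //; exact: rint_cst.
have al0 : (\int[q]_t al t = 0)%R.
  by rewrite RintegralD//; [rewrite Rint_cst subrr|exact: rint_cst].
have mw : measurable_fun setT w by exact: measurable_funX.
have wi : rint w.
  apply: measurable_bounded_integrable => //; first by rewrite prob_kernel ltry.
  exists 1%R; split=> // r r1 y _ /=.
  by have /andP[w0 w1] := w01 y; rewrite ger0_norm// (le_trans w1)// ltW.
have ki : rint k.
  apply: (@le_integrable _ _ _ _ _ measurableT _
    (EFin \o (fun t => 2 * u * al t + - u ^+ 2)%R)).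
  - apply/measurable_EFinP; apply: measurable_funM => //.
    apply: measurable_funB => //; apply: measurable_funM => //.
    exact: measurable_funB.
  - move=> t _ /=; rewrite lee_fin normrM ler_piMl//.
    by have /andP[w0 w1] := w01 t; rewrite ger0_norm.
  - by apply: rintD; [exact: rintZ|exact: rint_cst].
pose K := (\int[q]_t k t)%R; pose m := (\int[q]_t w t)%R.
pose G s := \int[q]_t ((phi t - phi s) ^+ 2 * (g t - g s) ^+ 2)%:E.
have mG0 : nnmeas (fun z : T * T =>
    ((phi z.1 - phi z.2) ^+ 2 * (g z.1 - g z.2) ^+ 2)%:E).
  split=> [z|]; first by rewrite lee_fin mulr_ge0// sqr_ge0.
  apply/measurable_EFinP; apply: measurable_funM; apply: measurable_funX;
    by apply: measurable_funB; exact: measurableT_comp.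
have Gn : nnmeas G.
  exact: (nnmeas_comp (pair1_measurable x) (iop_nn (int_op_posterior_section Q) mG0)).
have inner s : (K + ((- 2 * u * m) * al s + k s))%:E <= 2%:E * G s.
  have cs : rint (cst (k s)) by exact: rint_cst.
  have i2 : rint (fun t => (- 2 * u * al s) * w t + k s)%R.
    by apply: rintD => //; exact: rintZ.
  have i1 : rint (fun t => (- 2 * u * w s) * al t)%R by exact: rintZ.
  have -> : (K + ((- 2 * u * m) * al s + k s) = \int[q]_t
      (k t + ((- 2 * u * w s) * al t + ((- 2 * u * al s) * w t + k s))))%R.
    rewrite RintegralD//; last exact: rintD.
    rewrite RintegralD// RintegralZl// al0 mulr0 add0r.
    rewrite RintegralD//; last exact: rintZ.
    by rewrite RintegralZl// Rint_cst -/K -/m; ring.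
  have mGs : nnmeas (fun t => ((phi t - phi s) ^+ 2 * (g t - g s) ^+ 2)%:E).
    exact: (nnmeas_comp (pair2_measurable s) mG0).
  rewrite /G -nn_integralZ//.
  apply: Rintegral_le_ge0.
  - by apply: rintD => //; exact: rintD.
  - by apply: nnmeasM => //; exact: nnmeas_cst.
  - move=> t; rewrite -EFinM lee_fin /k /al /w.
    set x1 := g t; set y1 := g s.
    have -> : phi t = (al t + a)%R by rewrite /al subrK.
    have -> : phi s = (al s + a)%R by rewrite /al subrK.
    set A := al t; set B := al s.
    (* The first square is the arithmetic-geometric mean step, the second the
       bound [(x1 + y1)^2 <= 2 (x1^2 + y1^2)]. *)
    have := sqr_ge0 (2 * (A - B) * (x1 - y1) - u * (x1 + y1))%R.
    have := sqr_ge0 (u * (x1 - y1))%R.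
    nra.
have outer : (K + K)%:E <= 2%:E * \int[q]_s G s.
  have i1 : rint (fun s => (- 2 * u * m) * al s)%R by exact: rintZ.
  have -> : (K + K = \int[q]_s (K + ((- 2 * u * m) * al s + k s)))%R.
    rewrite RintegralD//; [|exact: rint_cst|exact: rintD].
    by rewrite Rint_cst RintegralD// RintegralZl// al0 mulr0 add0r.
  rewrite -nn_integralZ//.
  apply: Rintegral_le_ge0 => //.
  - by apply: rintD; [exact: rint_cst|exact: rintD].
  - by apply: nnmeasM => //; exact: nnmeas_cst.
have KG : K%:E <= \int[q]_s G s.
  have : 0 <= \int[q]_s G s by exact: nn_integral_ge0.
  move: outer; case: (\int[q]_s G s) => [r + _|_ _|//].
    by rewrite -EFinM !lee_fin; lra.
  by rewrite leey.
(* Where the loss of [b] is finite, the loss of [a] is that of [b] plus [K]. *)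
have [By|] := eqVneq (\int[q]_t (g t ^+ 2 * (phi t - b) ^+ 2)%:E) +oo.
  by rewrite By addye ?leey// gt_eqF// (lt_le_trans _ KG)// ltNyr.
rewrite -ltey => Bfin.
have mB : measurable_fun setT (fun t => (g t ^+ 2 * (phi t - b) ^+ 2)%R).
  apply: measurable_funM; first exact: measurable_funX.
  by apply: measurable_funX; apply: measurable_funB.
have Bi : rint (fun t => g t ^+ 2 * (phi t - b) ^+ 2)%R.
  apply/integrableP; split; first exact/measurable_EFinP.
  rewrite (eq_integral (fun t => (g t ^+ 2 * (phi t - b) ^+ 2)%:E))// => t _.
  by rewrite /= ger0_norm// mulr_ge0 ?sqr_ge0.
have -> : \int[q]_t (g t ^+ 2 * (phi t - a) ^+ 2)%:E =
    \int[q]_t (g t ^+ 2 * (phi t - b) ^+ 2 + k t)%:E.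
  by apply: eq_integral => t _; rewrite /k /w /al /u; congr EFin; ring.
under eq_integral do rewrite EFinD.
rewrite integralD_EFin//; apply: leeD => //.
by rewrite -[leLHS]fineK//; exact: integrable_fin_num.
Qed.

End posterior_covariance.

(** * Integrated risk and energy *)
Section bayes_regret.
Context (R : realType) (dX dT : measure_display).
Context (X : measurableType dX) (Theta : measurableType dT).
Variables (P : R.-pker Theta ~> X) (Q : R.-pker X ~> Theta).
Variable nu : {measure set Theta -> \bar R}.

Local Notation M := (marginal P nu).

Lemma enorm_sqr p (v : 'rV[R]_p) :
  (enorm v ^+ 2 = \sum_(i < p) v ord0 i ^+ 2)%R.
Proof. by rewrite sqr_sqrtr// sumr_ge0// => i _; exact: sqr_ge0. Qed.

Section loss.
Variables (p : nat) (phi : Theta -> 'rV[R]_p) (delta : X -> 'rV[R]_p).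
Hypotheses (mphi : measurable_vec phi) (mdelta : measurable_vec delta).

Lemma nnmeas_loss : nnmeas (fun z : X * Theta =>
  (enorm (phi z.2 - delta z.1) ^+ 2)%:E).
Proof.
split=> [z|]; first by rewrite lee_fin sqr_ge0.
apply/measurable_EFinP; under eq_fun do rewrite enorm_sqr.
apply: measurable_sum => i; apply: measurable_funX.
under eq_fun do rewrite !mxE.
apply: measurable_funB.
  exact: measurableT_comp (mphi i) measurable_snd.
exact: measurableT_comp (mdelta i) measurable_fst.
Qed.

Lemma nnmeas_risk : nnmeas (risk P phi delta).
Proof.
exact: (iop_nn (int_op_kernel P)
  (nnmeas_comp (@measurable_swap _ _ Theta X) nnmeas_loss)).
Qed.

(** Bayes risk as an average of posterior losses. *)
Lemma integral_weighted_risk (w : Theta -> \bar R) :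
  formal_posterior P Q nu -> nnmeas w ->
  \int[nu]_t (w t * risk P phi delta t) =
  \int[M]_x \int[Q x]_t (w t * (enorm (phi t - delta x) ^+ 2)%:E).
Proof.
move=> Q_post wn.
rewrite (integral_posterior Q_post (g := fun z =>
  w z.2 * (enorm (phi z.2 - delta z.1) ^+ 2)%:E)) /=.
  apply: eq_integral => t _; rewrite ge0_integralZl//.
  - exact: measurableT_comp nnmeas_loss.2 (pair2_measurable t).
  - by move=> x _; exact: (nnmeas_loss.1 (x, t)).
  - exact: wn.1.
apply: nnmeasM; last exact: nnmeas_loss.
exact: nnmeas_comp measurable_snd wn.
Qed.

End loss.

Lemma measurable_posterior_mean p (phi : Theta -> 'rV[R]_p) :
  measurable_vec phi -> measurable_vec (posterior_mean Q phi).
Proof.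
move=> mphi i; rewrite /posterior_mean.
under eq_fun do rewrite mxE.
apply: (measurableT_comp (f := fine)) => //.
under eq_fun do rewrite integralE.
have mi : measurable_fun setT (EFin \o (fun t => phi t ord0 i)).
  by apply/measurable_EFinP; exact: mphi.
apply: emeasurable_funB; apply: measurable_fun_integral_kernel => //.
- by move=> U mU; exact: measurable_kernel.
- exact: measurable_funepos.
- by move=> U mU; exact: measurable_kernel.
- exact: measurable_funeneg.
Qed.

Variable f : Theta * Theta -> R.
Hypotheses (mf : measurable_fun setT f) (f_ge0 : forall z, (0 <= f z)%R).
Hypothesis Tnorm_fin : forall eta, Tnorm P Q f eta < +oo.
Hypothesis Q_posterior : formal_posterior P Q nu.

Variables (p : nat) (phi : Theta -> 'rV[R]_p).
Hypothesis mphi : measurable_vec phi.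
Variable (C : R).
Hypothesis C0 : (0 < C)%R.
Hypothesis phi_lip : forall t eta, (enorm (phi t - phi eta) ^+ 2 <= C * f (t, eta))%R.

Let nnf : nnmeas (EFin \o f).
Proof. by split=> [z|]; [rewrite lee_fin|exact/measurable_EFinP]. Qed.

(** Finiteness of [Tnorm] at [eta] makes [f (., eta)] integrable for
    [Q(.|x)], for [P(.|eta)]-almost every [x]; there
    [|phi_i t| <= |phi_i eta| + 1 + C f (t, eta)] is integrable too.  So the
    exceptional set is [P(.|eta)]-null for every [eta], hence null for the
    marginal. *)
Lemma ae_posterior_integrable : {ae M, forall x, forall i,
  (Q x).-integrable setT (EFin \o (fun t => phi t ord0 i))}.
Proof.
have mi i : measurable_fun setT (EFin \o (fun t => phi t ord0 i)).
  by apply/measurable_EFinP; exact: mphi.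
pose I i x := \int[Q x]_t `|(phi t ord0 i)%:E|.
have mai i : measurable_fun setT (fun t => `|(phi t ord0 i)%:E|).
  exact: measurableT_comp (mi i).
have In i : nnmeas (I i).
  split=> [x|]; first exact: integral_ge0.
  apply: measurable_fun_integral_kernel => //.
  by move=> U mU; exact: measurable_kernel.
pose N i := I i @^-1` [set +oo].
have mN i : measurable (N i).
  by rewrite -[X in measurable X]setTI; exact: (In i).2.
have PN i eta : P eta (N i) = 0.
  pose V x := \int[Q x]_t (f (t, eta))%:E.
  have nfe : nnmeas (fun t => (f (t, eta))%:E).
    exact: (nnmeas_comp (pair2_measurable eta) nnf).
  have Vn : nnmeas V.
    split=> [x|]; first by apply: integral_ge0 => t _; exact: nfe.1.
    apply: measurable_fun_integral_kernel => //; [|exact: nfe.1|exact: nfe.2].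
    by move=> U mU; exact: measurable_kernel.
  have Vi : (P eta).-integrable setT V.
    apply/integrableP; split; first exact: Vn.2.
    under eq_integral do rewrite gee0_abs ?Vn.1//.
    by rewrite -integral_expected_posterior//; exact: Tnorm_fin.
  have [N' [mN' PN' VN']] := integrable_ae measurableT Vi.
  apply: (subset_measure0 (mN i) mN' _ PN') => x Ix; apply: VN' => /= /(_ Logic.I) Vx.
  suff : I i x < +oo by rewrite [I i x]Ix ltxx.
  have cn : nnmeas (fun _ : Theta => (`|phi eta ord0 i| + 1)%:E : \bar R).
    by apply: nnmeas_cst; rewrite addr_ge0.
  have Cfn : nnmeas (fun t => C%:E * (f (t, eta))%:E).
    by apply: nnmeasM => //; apply: nnmeas_cst; exact: ltW.
  apply: (@le_lt_trans _ _
    (\int[Q x]_t ((`|phi eta ord0 i| + 1)%:E + C%:E * (f (t, eta))%:E))).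
    apply: ge0_le_integral => //.
    - exact: (nnmeasD cn Cfn).2.
    - move=> t _; rewrite -EFinM -EFinD abse_EFin lee_fin.
      have lip_i : ((phi t ord0 i - phi eta ord0 i) ^+ 2 <= C * f (t, eta))%R.
        apply: le_trans (phi_lip t eta); rewrite enorm_sqr (bigD1 i)//= !mxE.
        by rewrite lerDl sumr_ge0// => j _; exact: sqr_ge0.
      have := ler_normD (phi eta ord0 i) (phi t ord0 i - phi eta ord0 i)%R.
      rewrite subrKC => /le_trans; apply; rewrite -addrA lerD2l.
      apply: le_trans (_ : 1 + (phi t ord0 i - phi eta ord0 i) ^+ 2 <= _)%R.
        rewrite -real_normK ?num_real//; set y := `|_|%R.
        have y0 : (0 <= y)%R by exact: normr_ge0.
        by have := sqr_ge0 (y - 1)%R; nra.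
      by rewrite lerD2l.
  rewrite nn_integralD// integral_cst// prob_kernel mule1.
  rewrite nn_integralZ//; last exact: ltW.
  by rewrite -/(V x) -(fineK Vx) -EFinM -EFinD ltry.
have MN i : M (N i) = 0 by rewrite [LHS]integral0_eq// => t _; exact: PN.
apply: filter_forall => i; exists (N i); split => // x /= nint.
apply: contrapT => Nx; apply: nint; apply/integrableP; split=> //.
by rewrite ltey; apply/eqP.
Qed.

Lemma bayes_regret_le (g : Theta -> R) (delta : X -> 'rV[R]_p) :
  measurable_fun setT g -> (forall t, (0 <= g t <= 1)%R) -> measurable_vec delta ->
  \int[nu]_t ((g t ^+ 2)%:E * risk P phi (posterior_mean Q phi) t) <=
  \int[nu]_t ((g t ^+ 2)%:E * risk P phi delta t) +
  C%:E * pair_integral P Q nu (fun z => (f z * (g z.1 - g z.2) ^+ 2)%:E).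
Proof.
move=> mg g01 mdelta.
have mhat := measurable_posterior_mean mphi.
have wn : nnmeas (fun t => (g t ^+ 2)%:E).
  split=> [t|]; first by rewrite lee_fin sqr_ge0.
  by apply/measurable_EFinP; exact: measurable_funX.
have Fn : nnmeas (fun z => (f z * (g z.1 - g z.2) ^+ 2)%:E).
  split=> [z|]; first by rewrite lee_fin mulr_ge0// sqr_ge0.
  apply/measurable_EFinP; apply: measurable_funM => //.
  by apply: measurable_funX; apply: measurable_funB; exact: measurableT_comp.
rewrite !integral_weighted_risk//.
pose L d x := \int[Q x]_t ((g t ^+ 2)%:E * (enorm (phi t - d x) ^+ 2)%:E).
pose E x := \int[Q x]_e \int[Q x]_t (f (t, e) * (g t - g e) ^+ 2)%:E.
have lossn d : measurable_vec d -> nnmeas (fun z : X * Theta =>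
    (g z.2 ^+ 2)%:E * (enorm (phi z.2 - d z.1) ^+ 2)%:E).
  move=> md; apply: nnmeasM; last exact: nnmeas_loss.
  exact: (nnmeas_comp measurable_snd wn).
have Ln d : measurable_vec d -> nnmeas (L d).
  by move=> md; exact: (iop_nn (int_op_kernel Q) (lossn d md)).
have En : nnmeas E.
  exact: (iop_nn (int_op_posterior_pair Q) Fn).
rewrite /pair_integral -/(E _).
rewrite -nn_integralZ//; last exact: ltW.
have CEn : nnmeas (fun x => C%:E * E x).
  by apply: nnmeasM => //; apply: nnmeas_cst; exact: ltW.
rewrite -nn_integralD//; last exact: Ln.
apply: ae_ge0_le_integral => //.
- by move=> x _; exact: (Ln _ mhat).1.
- exact: (Ln _ mhat).2.
- by move=> x _; exact: (nnmeasD (Ln _ mdelta) CEn).1.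
- exact: (nnmeasD (Ln _ mdelta) CEn).2.
apply: filterS ae_posterior_integrable => x xint _.
pose opQ := @int_op_integral R _ _ unit Theta (Q x) setT measurableT.
pose ls i (b : R) t := (g t ^+ 2 * (phi t ord0 i - b) ^+ 2)%:E.
have lsn i b : nnmeas (ls i b).
  split=> [t|]; first by rewrite lee_fin mulr_ge0// sqr_ge0.
  apply/measurable_EFinP; apply: measurable_funM; first exact: measurable_funX.
  by apply: measurable_funX; apply: measurable_funB => //; exact: mphi.
have LE d : L d x = \sum_(i < p) \int[Q x]_t ls i (d x ord0 i) t.
  rewrite -((iop_sum _ opQ (fun i => lsn i (d x ord0 i))).2 tt).
  apply: eq_integral => t _; rewrite -EFinM enorm_sqr mulr_sumr -sumEFin.
  by apply: eq_bigr => i _; rewrite !mxE.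
pose cv i (z : Theta * Theta) := ((phi z.1 ord0 i - phi z.2 ord0 i) ^+ 2 *
   (g z.1 - g z.2) ^+ 2)%:E.
have cvn i : nnmeas (cv i).
  split=> [t|]; first by rewrite lee_fin mulr_ge0// sqr_ge0.
  apply/measurable_EFinP; apply: measurable_funM; apply: measurable_funX;
    apply: measurable_funB.
  - exact: measurableT_comp (mphi i) measurable_fst.
  - exact: measurableT_comp (mphi i) measurable_snd.
  - exact: measurableT_comp mg measurable_fst.
  - exact: measurableT_comp mg measurable_snd.
suff : L (posterior_mean Q phi) x <= L delta x + C%:E * E x by [].
rewrite !LE; apply: (@le_trans _ _ (\sum_(i < p) (\int[Q x]_t ls i (delta x ord0 i) t +
    \int[Q x]_e \int[Q x]_t cv i (t, e)))).
  apply: lee_sum => i _; rewrite mxE.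
  exact: (posterior_regret_le (xint i) mg g01).
rewrite big_split/=; apply: leeD => //.
have opQQ := int_op_posterior_pair Q.
have [cvsn <-] := iop_sum (index_enum 'I_p) opQQ cvn.
have -> : C%:E * E x = \int[Q x]_e \int[Q x]_t
    (C%:E * (f (t, e) * (g t - g e) ^+ 2)%:E).
  exact: (esym (iopZ opQQ (ltW C0) Fn x)).
have CFn : nnmeas (fun z => C%:E * (f z * (g z.1 - g z.2) ^+ 2)%:E).
  by apply: nnmeasM => //; apply: nnmeas_cst; exact: ltW.
refine (iop_le opQQ cvsn CFn _ x) => -[t e].
rewrite /cv sumEFin -EFinM lee_fin -mulr_suml [leRHS]mulrA.
apply: ler_wpM2r; first exact: sqr_ge0.
apply: le_trans (phi_lip t e); rewrite enorm_sqr.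
by apply: ler_sum => i _; rewrite !mxE.
Qed.

End bayes_regret.

(** * Hitting a set inside an exhaustion *)
Lemma nested_le (T : Type) (E : nat -> set T) : (forall n, E n `<=` E n.+1) ->
  forall m n, (m <= n)%N -> E m `<=` E n.
Proof.
move=> E_nd m; elim=> [|n IH]; first by rewrite leqn0 => /eqP ->.
by rewrite leq_eqVlt => /predU1P[->//|/IH /subset_trans]; apply.
Qed.

Section killed_hitting_probability.
Context (R : realType) (d : measure_display) (S : measurableType d).
Variable L : (S -> \bar R) -> S -> \bar R.
Hypothesis L_op : int_op L.
Hypothesis L1 : forall e, L (fun=> 1) e <= 1.
Variables (D : set S) (E : nat -> set S).
Hypotheses (mD : measurable D) (mE : forall n, measurable (E n)).
Hypotheses (DE : forall n, D `<=` E n) (E_nd : forall n, E n `<=` E n.+1).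
Hypothesis E_cover : \bigcup_n E n = setT.

(** When [L] is the transition operator of a Markov chain, [killed_hit n e] is
    the probability that the chain started at [e] visits [D] within [n] steps,
    if it is killed when, with [m.+1] steps left, it is outside [E m].
    Letting the killing set depend on the step makes a single sequence both
    exhaust the space and iterate the operator. *)
Fixpoint killed_hit (n : nat) : S -> \bar R :=
  if n is n'.+1 then fun e =>
    (\1_D e)%:E + (\1_(E n' `\` D) e)%:E * L (killed_hit n') e
  else fun e => (\1_D e)%:E.

Lemma nnmeas_killed_hit n : nnmeas (killed_hit n).
Proof.
elim: n => [|n IH] /=; first exact: nnmeas_indic.
apply: nnmeasD; first exact: nnmeas_indic.
apply: nnmeasM; last exact: iop_nn.
by apply: nnmeas_indic; exact: measurableD.
Qed.

Lemma killed_hit_target n e : D e -> killed_hit n e = 1.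
Proof.
move=> De; case: n => [|n] /=; rewrite indicE mem_set//.
by rewrite indicE memNset ?mul0e ?adde0// => -[].
Qed.

Lemma killed_hitS n e : ~ D e -> E n e -> killed_hit n.+1 e = L (killed_hit n) e.
Proof.
by move=> De Ee /=; rewrite indicE memNset// indicE mem_set// mul1e add0e.
Qed.

Lemma killed_hit_out n e : ~ E n e -> killed_hit n e = 0.
Proof.
case: n => [|n] Ee /=; (rewrite indicE memNset; last by move=> /DE/Ee) => //.
by rewrite add0e indicE memNset ?mul0e// => -[/E_nd/Ee].
Qed.

Lemma killed_hit_le1 n e : killed_hit n e <= 1.
Proof.
elim: n e => [|n IH] e; first by rewrite lee_fin indicE; case: (_ \in _).
have [De|De] := pselect (D e); first by rewrite killed_hit_target.
have [Ee|Ee] := pselect (E n e); last first.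
  by rewrite /= indicE memNset// indicE memNset ?mul0e ?adde0// => -[].
rewrite killed_hitS//; apply: le_trans (L1 e); apply: iop_le => //.
exact: nnmeas_killed_hit.
Qed.

Lemma killed_hit_leS n e : killed_hit n e <= killed_hit n.+1 e.
Proof.
elim: n e => [|n IH] e.
  rewrite /= leeDl// mule_ge0// ?lee_fin//.
  exact: (iop_nn L_op (nnmeas_killed_hit 0)).1.
have [De|De] := pselect (D e); first by rewrite !killed_hit_target.
have [Ee|Ee] := pselect (E n e).
  rewrite !killed_hitS//; last exact: E_nd.
  by apply: iop_le => //; exact: nnmeas_killed_hit.
rewrite [leLHS](_ : _ = 0); first exact: (nnmeas_killed_hit _).1.
by rewrite /= indicE memNset// indicE memNset ?mul0e ?adde0// => -[].
Qed.

Lemma killed_hit_nd e : nondecreasing_seq (killed_hit ^~ e).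
Proof. by apply/nondecreasing_seqP => n; exact: killed_hit_leS. Qed.

(** Off [D] a positive value is [L] of the previous term, and the sequence
    increases. *)
Lemma killed_hit_subharmonic n e :
  ~ D e -> 0 < killed_hit n e -> killed_hit n e <= L (killed_hit n) e.
Proof.
case: n => [|n] De; first by rewrite /= indicE memNset// ltxx.
have [Ee|Ee] := pselect (E n e); last first.
  by rewrite /= indicE memNset// indicE memNset ?mul0e ?adde0 ?ltxx// => -[].
move=> _; rewrite killed_hitS//.
by apply: iop_le => //; [exact: nnmeas_killed_hit..|exact: killed_hit_leS].
Qed.

Definition hit_limit e := limn (killed_hit ^~ e).

Lemma nnmeas_hit_limit : nnmeas hit_limit.
Proof. exact: nnmeas_lim nnmeas_killed_hit killed_hit_nd. Qed.

Lemma hit_limit_target e : D e -> 1 <= hit_limit e.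
Proof.
move=> De; rewrite /hit_limit.
apply: lime_ge; first exact/ereal_nondecreasing_is_cvgn/killed_hit_nd.
by apply: nearW => n; rewrite killed_hit_target.
Qed.

Lemma L_hit_limit e : L hit_limit e = limn (fun n => L (killed_hit n) e).
Proof. exact: (iop_lim L_op nnmeas_killed_hit killed_hit_nd). Qed.

Lemma is_cvg_L_killed_hit e : cvgn (fun n => L (killed_hit n) e).
Proof.
apply: ereal_nondecreasing_is_cvgn => m n mn.
by apply: iop_le => //; [exact: nnmeas_killed_hit..|move=> t; exact: killed_hit_nd].
Qed.

(** Each point lies in [E n] for large [n], and from then on
    [L (killed_hit n) e] is the next term of the sequence. *)
Lemma hit_limit_superharmonic e : ~ D e -> L hit_limit e <= hit_limit e.
Proof.
move=> De; rewrite L_hit_limit.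
apply: lime_le; first exact: is_cvg_L_killed_hit.
have [N _ EN] : (\bigcup_n E n) e by rewrite E_cover.
exists N => // n /= Nn.
have Ene : E n e by exact: (nested_le E_nd) EN.
rewrite -killed_hitS// /hit_limit.
apply: lime_ge; first exact/ereal_nondecreasing_is_cvgn/killed_hit_nd.
by exists n.+1 => // m nm; exact: killed_hit_nd.
Qed.

End killed_hitting_probability.

(** * The transition operator *)
Section transition_operator.
Context (R : realType) (dX dT : measure_display).
Context (X : measurableType dX) (Theta : measurableType dT).
Variables (P : R.-pker Theta ~> X) (Q : R.-pker X ~> Theta).
Variable f : Theta * Theta -> R.
Hypotheses (mf : measurable_fun setT f) (f_ge0 : forall z, (0 <= f z)%R).

Local Notation tau := (Tnorm P Q f).
Local Notation EP := (expected_posterior P Q).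

Let nnf : nnmeas (EFin \o f).
Proof. by split=> [z|]; [rewrite lee_fin|exact/measurable_EFinP]. Qed.

Lemma int_op_expected_posterior :
  int_op (fun (F : Theta * Theta -> \bar R) e => \int[EP e]_t F (t, e)).
Proof.
exact: (int_op_comp (int_op_kernel (mkcomp_noparam P Q))
  (int_op_precomp R (@measurable_swap _ _ Theta Theta))).
Qed.

Lemma nnmeas_Tnorm : nnmeas tau.
Proof. exact: (iop_nn int_op_expected_posterior nnf). Qed.

Definition transition_op (g : Theta -> \bar R) (e : Theta) : \bar R :=
  \int[EP e]_t ((f (t, e) / fine (tau e))%:E * g t).

Hypothesis tau_pos : forall e, 0 < tau e < +oo.

Let tau_fine e : (0 < fine (tau e))%R.
Proof. by apply: fine_gt0; exact: tau_pos. Qed.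

Let tauK e : (fine (tau e))%:E = tau e.
Proof.
by rewrite fineK// ge0_fin_numE; [case/andP: (tau_pos e)|exact: nnmeas_Tnorm.1].
Qed.

Lemma int_op_transition : int_op transition_op.
Proof.
pose w (z : Theta * Theta) := (f z / fine (tau z.2))%:E : \bar R.
have wn : nnmeas w.
  split=> [z|]; first by rewrite lee_fin divr_ge0// ltW.
  apply/measurable_EFinP; apply: measurable_funM => //.
  under eq_fun do rewrite -powR_inv1 ?ltW//.
  apply: (measurableT_comp (f := fun r : R => r `^ (-1))%R).
    exact: measurable_powR.
  apply: (measurableT_comp (f := fine)) => //.
  exact: measurableT_comp nnmeas_Tnorm.2 measurable_snd.
exact: (int_op_comp int_op_expected_posterior
  (int_op_comp (int_op_mul wn (fun=> isT))
    (int_op_precomp R (@measurable_fst _ _ Theta Theta)))).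
Qed.

Lemma transition_op_indic A e : measurable A ->
  transition_op (fun t => (\1_A t)%:E) e = transition_kernel P Q f e A.
Proof.
move=> mA; rewrite /transition_kernel integral_mkcond; apply: eq_integral => t _.
by rewrite patchE indicE; case: (t \in A); rewrite ?mule1 ?mule0.
Qed.

(** The density of [T(dt|e) tau(e)] with respect to [R(dt|e)] is [f]. *)
Lemma Tnorm_transition g e : nnmeas g ->
  tau e * transition_op g e = \int[EP e]_t ((f (t, e))%:E * g t).
Proof.
move=> gn; rewrite -tauK /transition_op -nn_integralZ//.
- apply: eq_integral => t _; rewrite muleA -EFinM mulrC divfK//.
  by rewrite gt_eqF.
- exact: ltW.
- apply: nnmeasM => //; split=> [t|].
    by rewrite lee_fin divr_ge0// ltW.
  apply/measurable_EFinP; apply: measurable_funM => //.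
  exact: measurableT_comp mf (pair2_measurable e).
Qed.

Lemma transition_op1_le1 e : transition_op (fun=> 1) e <= 1.
Proof.
have n1 : nnmeas (fun _ : Theta => 1 : \bar R) by exact: (nnmeas_cst _ ler01).
have /andP[tau0 _] := tau_pos e.
have tau_fin : tau e \is a fin_num by rewrite -tauK.
rewrite -(lee_pmul2l tau_fin tau0) mule1 (Tnorm_transition e n1).
rewrite (eq_integral (fun t => (f (t, e))%:E))// => t _.
by rewrite mule1.
Qed.

End transition_operator.

(** * Dirichlet form of the reversible chain *)
Section dirichlet_energy.
Context (R : realType) (dX dT : measure_display).
Context (X : measurableType dX) (Theta : measurableType dT).
Variables (P : R.-pker Theta ~> X) (Q : R.-pker X ~> Theta).
Variable nu : {measure set Theta -> \bar R}.
Hypothesis Q_posterior : formal_posterior P Q nu.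
Variable f : Theta * Theta -> R.
Hypotheses (mf : measurable_fun setT f) (f_ge0 : forall z, (0 <= f z)%R).
Hypothesis f_sym : forall t eta, f (t, eta) = f (eta, t).
Hypothesis tau_pos : forall e, 0 < Tnorm P Q f e < +oo.

Local Notation tau := (Tnorm P Q f).
Local Notation EP := (expected_posterior P Q).
Local Notation T := (transition_op P Q f).
Local Notation J := (pair_integral P Q nu).

Definition energy (g : Theta -> R) : \bar R :=
  J (fun z => (f z * (g z.1 - g z.2) ^+ 2)%:E).

(** The identity [energy g = 2 <g, (I - T) g>] in the space of functions square
    integrable against [tau * nu], written without subtraction: expand
    [(g t - g e)^2], and use the symmetry of [f] and of the pair integral to
    identify the two square terms. *)
Lemma energy_identity (g : Theta -> R) :
  measurable_fun setT g -> (forall e, (0 <= g e)%R) ->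
  energy g + 2%:E * \int[nu]_e (tau e * ((g e)%:E * T (EFin \o g) e)) =
  2%:E * \int[nu]_e (tau e * (g e ^+ 2)%:E).
Proof.
move=> mg g0.
have mg1 : measurable_fun setT (fun z : Theta * Theta => g z.1).
  exact: measurableT_comp.
have mg2 : measurable_fun setT (fun z : Theta * Theta => g z.2).
  exact: measurableT_comp.
have gn : nnmeas (EFin \o g).
  by split=> [e|]; [rewrite lee_fin|exact/measurable_EFinP].
have Jop : int_op (fun F (_ : unit) => J F).
  exact: (int_op_comp (@int_op_integral R _ _ unit X (marginal P nu) setT
    measurableT) (int_op_posterior_pair Q)).
have nF (h : Theta * Theta -> R) : measurable_fun setT h ->
    (forall z, (0 <= h z)%R) -> nnmeas (fun z => (f z * h z)%:E).
  move=> mh h0; split=> [z|]; first by rewrite lee_fin mulr_ge0.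
  by apply/measurable_EFinP; exact: measurable_funM.
pose F1 z := (f z * g z.1 ^+ 2)%:E; pose F2 z := (f z * g z.2 ^+ 2)%:E.
pose F3 z := (f z * (g z.1 * g z.2))%:E.
pose F4 z := (f z * (g z.1 - g z.2) ^+ 2)%:E.
have F1n : nnmeas F1.
  by apply: nF => [|z]; [exact: measurable_funX|exact: sqr_ge0].
have F2n : nnmeas F2.
  by apply: nF => [|z]; [exact: measurable_funX|exact: sqr_ge0].
have F3n : nnmeas F3.
  by apply: nF => [|z]; [exact: measurable_funM|exact: mulr_ge0].
have F4n : nnmeas F4.
  apply: nF => [|z]; last exact: sqr_ge0.
  by apply: measurable_funX; exact: measurable_funB.
have two0 : (0 <= 2 :> R)%R by [].
have JF2 : J F2 = \int[nu]_e (tau e * (g e ^+ 2)%:E).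
  rewrite (pair_integralE Q_posterior F2n); apply: eq_integral => e _.
  rewrite muleC -nn_integralZ ?sqr_ge0//; last first.
    split=> [t|]; first by rewrite lee_fin.
    by apply/measurable_EFinP; exact: measurableT_comp mf (pair2_measurable e).
  by apply: eq_integral => t _; rewrite -EFinM mulrC.
have JF1 : J F1 = J F2.
  rewrite (_ : F2 = (fun z => F1 (z.2, z.1))).
    exact: pair_integral_swap F1n.
  by apply/funext => -[t e]; rewrite /F1 /F2 /= f_sym.
have JF3 : J F3 = \int[nu]_e (tau e * ((g e)%:E * T (EFin \o g) e)).
  rewrite (pair_integralE Q_posterior F3n); apply: eq_integral => e _.
  rewrite muleCA.
  rewrite (Tnorm_transition mf f_ge0 tau_pos e gn).
  have fn : nnmeas (fun t => (f (t, e))%:E).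
    split=> [t|]; first by rewrite lee_fin.
    by apply/measurable_EFinP; exact: measurableT_comp mf (pair2_measurable e).
  rewrite -(nn_integralZ _ measurableT (g0 e) (nnmeasM fn gn)).
  by apply: eq_integral => t _; rewrite -!EFinM /=; congr EFin; ring.
have J2 : J (fun z => 2%:E * F3 z) = 2%:E * J F3 := iopZ Jop two0 F3n tt.
have n2F3 := nnmeasM (nnmeas_cst _ two0) F3n.
have JD : J (fun z => F4 z + 2%:E * F3 z) = J F4 + J (fun z => 2%:E * F3 z) :=
  iopD Jop F4n n2F3 tt.
have JD' : J (fun z => F1 z + F2 z) = J F1 + J F2 := iopD Jop F1n F2n tt.
have F43 : (fun z => F4 z + 2%:E * F3 z) = (fun z => F1 z + F2 z).
  apply/funext => z; rewrite /F1 /F2 /F3 /F4 -EFinM -!EFinD.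
  by congr EFin; ring.
(* Both sides are the pair integral of the two square terms. *)
rewrite -JF3 -J2; transitivity (J (fun z => F1 z + F2 z)).
  exact: (etrans (esym JD) (congr1 J F43)).
rewrite JD' JF1 JF2.
by rewrite mule_natl mule2n.
Qed.

(** In [<g, (I - T) g>] the part off [D] is nonpositive by subharmonicity, and
    on [D], where [g = 1], the integrand is [1 - T g]. *)
Lemma energy_le (D : set Theta) (g : Theta -> R) :
  measurable D -> measurable_fun setT g -> (forall e, (0 <= g e)%R) ->
  (forall e, D e -> g e = 1%R) ->
  (forall e, ~ D e -> (0 < g e)%R -> (g e)%:E <= T (EFin \o g) e) ->
  \int[nu]_(e in D) tau e < +oo ->
  \int[nu]_e (tau e * (g e ^+ 2)%:E) < +oo ->
  energy g + 2%:E * \int[nu]_(e in D) (tau e * T (EFin \o g) e) <=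
  2%:E * \int[nu]_(e in D) tau e.
Proof.
move=> mD mg g0 gD gsub tauD taug.
have T_op := int_op_transition mf f_ge0 tau_pos.
have gn : nnmeas (EFin \o g).
  by split=> [e|]; [rewrite lee_fin|exact/measurable_EFinP].
have Tn := iop_nn T_op gn.
have taun := nnmeas_Tnorm P Q mf f_ge0.
have g2n : nnmeas (fun e => (g e ^+ 2)%:E).
  split=> [e|]; first by rewrite lee_fin sqr_ge0.
  by apply/measurable_EFinP; exact: measurable_funX.
have Dn : nnmeas (fun e => (\1_D e)%:E : \bar R) by exact: nnmeas_indic.
have := energy_identity mg g0.
have a0 : 0 <= energy g.
  apply: integral_ge0 => x _; apply: integral_ge0 => e _.
  by apply: integral_ge0 => t _; rewrite lee_fin mulr_ge0// sqr_ge0.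
set a := energy g in a0 *.
set c := \int[nu]_e (tau e * ((g e)%:E * T (EFin \o g) e)).
set u := \int[nu]_e (tau e * (g e ^+ 2)%:E) in taug *.
set s := \int[nu]_(e in D) (tau e * T (EFin \o g) e).
set v := \int[nu]_(e in D) tau e in tauD *.
have cn := nnmeasM taun (nnmeasM gn Tn).
have un := nnmeasM taun g2n.
have sn := nnmeasM taun Tn.
have c0 : 0 <= c by exact: nn_integral_ge0 cn.
have u0 : 0 <= u by exact: nn_integral_ge0 un.
have s0 : 0 <= s by exact: nn_integral_ge0 sn.
have v0 : 0 <= v by exact: nn_integral_ge0.
have usvc : u + s <= v + c.
  rewrite /u /s /v /c (integral_indicM nu D (fun e => tau e * T (EFin \o g) e)).
  rewrite (integral_indicM nu D tau).
  have Dsn := nnmeasM Dn sn; have Dtn := nnmeasM Dn taun.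
  rewrite -(nn_integralD _ measurableT un Dsn).
  rewrite -(nn_integralD _ measurableT Dtn cn).
  apply: (nn_integral_le _ measurableT (nnmeasD un Dsn) (nnmeasD Dtn cn)).
  move=> e _; have [De|De] := pselect (D e).
    by rewrite indicE mem_set// /= gD// expr1n !(mule1, mul1e).
  rewrite indicE memNset// !mul0e adde0 add0e /=; apply: lee_wpmul2l; first exact: taun.1.
  have [->|ge] := eqVneq (g e) 0%R; first by rewrite expr0n /= ?mul0e.
  rewrite expr2 EFinM; apply: lee_wpmul2l; first by rewrite lee_fin.
  by apply: gsub => //; rewrite lt_def ge g0.
move=> id_acu.
(* Before subtracting: [a] and [c] are finite by the energy identity, then [s]
   is finite by [usvc]. *)
have fin (x y : \bar R) : 0 <= x -> x <= y -> y < +oo -> x \is a fin_num.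
  by move=> x0 xy yoo; rewrite ge0_fin_numE// (le_lt_trans xy).
have u2 : 2%:E * u < +oo by rewrite lte_mul_pinfty.
have c20 : 0 <= 2%:E * c by rewrite mule_ge0.
have af : a \is a fin_num by apply: (fin _ _ a0 _ u2); rewrite -id_acu leeDl.
have cf : c \is a fin_num.
  apply: (fin _ _ c0 _ u2); rewrite -id_acu; apply: le_trans (leeDr _ a0).
  by rewrite mule_natl mule2n leeDl.
have sf : s \is a fin_num.
  apply: (fin _ _ s0 (le_trans (leeDr _ u0) usvc)).
  by rewrite lte_add_pinfty// ltey_eq cf.
have vf : v \is a fin_num by rewrite ge0_fin_numE.
have uf : u \is a fin_num by rewrite ge0_fin_numE.
move: usvc id_acu; rewrite -(fineK af) -(fineK cf) -(fineK sf) -(fineK vf) -(fineK uf).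
rewrite -!EFinM -!EFinD !lee_fin => usvc [id_acu]; lra.
Qed.

End dirichlet_energy.

(** * Recurrence gives functions of small energy *)
Section recurrence.
Context (R : realType) (dX dT dO : measure_display).
Context (X : measurableType dX) (Theta : measurableType dT).
Context (Omega : measurableType dO).
Variables (P : R.-pker Theta ~> X) (Q : R.-pker X ~> Theta).
Variable nu : {measure set Theta -> \bar R}.
Hypothesis Q_posterior : formal_posterior P Q nu.
Variable f : Theta * Theta -> R.
Hypotheses (mf : measurable_fun setT f) (f_ge0 : forall z, (0 <= f z)%R).
Hypothesis f_sym : forall t eta, f (t, eta) = f (eta, t).
Hypothesis tau_pos : forall e, 0 < Tnorm P Q f e < +oo.
Variables (Pr : Theta -> probability Omega R) (W : nat -> Omega -> Theta).
Hypothesis W_chain : markov_chain (transition_kernel P Q f) Pr W.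

Local Notation tau := (Tnorm P Q f).
Local Notation T := (transition_op P Q f).

(** For the killed hitting probabilities [h n], the integral [s n] of [T (h n)]
    over [D] against [tau * nu] increases to at least the [tau * nu]-measure
    [v] of [D], because [T] of the limit dominates the return probability,
    which is one.  As the energy of [h n] is at most [2 (v - s n)], an [n] with
    [v - s n <= eps / 2] does. *)
Lemma recurrent_low_energy (D : set Theta) (E : nat -> set Theta) (eps : R) :
  measurable D -> (forall n, measurable (E n)) ->
  (forall n, D `<=` E n) -> (forall n, E n `<=` E n.+1) ->
  \bigcup_n E n = setT ->
  (forall n, \int[nu]_(e in E n) tau e < +oo) ->
  locally_recurrent_set nu Pr W D -> (0 < eps)%R ->
  exists (g : Theta -> R) (n : nat), [/\ measurable_fun setT g,
    forall e, (0 <= g e <= 1)%R, forall e, D e -> g e = 1%R,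
    forall e, ~ E n e -> g e = 0%R & energy P Q nu f g <= eps%:E].
Proof.
move=> mD mE DE E_nd E_cover tauE D_rec eps0.
have T_op := int_op_transition mf f_ge0 tau_pos.
have taun := nnmeas_Tnorm P Q mf f_ge0.
have tau_fin e : tau e \is a fin_num.
  by rewrite ge0_fin_numE; [case/andP: (tau_pos e)|exact: taun.1].
have T1 := transition_op1_le1 mf f_ge0 tau_pos.
pose h := killed_hit T D E.
have hn n : nnmeas (h n) := nnmeas_killed_hit T_op mD mE n.
have h1 n e : h n e <= 1 := killed_hit_le1 T_op T1 mD mE n e.
pose s n := \int[nu]_(e in D) (tau e * T (h n) e).
pose v := \int[nu]_(e in D) tau e.
have v0 : 0 <= v by exact: nn_integral_ge0.
have voo : v < +oo.
  apply: le_lt_trans (tauE 0%N); apply: ge0_subset_integral => //.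
  - exact: measurable_funTS taun.2.
  - by move=> e _; exact: taun.1.
have Sop := int_op_comp (@int_op_integral R _ _ unit Theta nu D mD)
  (int_op_comp (int_op_mul taun tau_fin) T_op).
have s_nd : nondecreasing_seq s.
  move=> m n mn; apply: (iop_le Sop (hn m) (hn n) _ tt) => e.
  exact: killed_hit_nd.
have v_le : v <= limn s.
  have <- : \int[nu]_(e in D) (tau e * T (hit_limit T D E) e) = limn s.
    exact: (iop_lim Sop hn (killed_hit_nd T_op mD mE E_nd) tt).
  have hoon := nnmeas_hit_limit T_op mD mE E_nd.
  have Thn := nnmeasM taun (iop_nn T_op hoon).
  apply: ae_ge0_le_integral => //.
  - by move=> e _; exact: taun.1.
  - exact: measurable_funTS taun.2.
  - by move=> e _; exact: Thn.1.
  - exact: measurable_funTS Thn.2.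
  have [N [mN N0 recN]] := D_rec.
  exists N; split => // w nle; apply: recN => hit; apply: nle => Dw.
  have Prw := hit Dw.
  rewrite -[leLHS]mule1; apply: lee_wpmul2l; first exact: taun.1.
  rewrite -Prw; apply: (hitting_le_superharmonic W_chain T_op) => //.
  - by move=> A e mA; exact: transition_op_indic.
  - exact: hit_limit_target.
  - exact: hit_limit_superharmonic.
(* Here finiteness of [v] matters: the limit of [s] exceeds [v - eps / 2]. *)
have [n vs] : exists n, v <= s n + (eps / 2)%:E.
  apply: contrapT => /forallNP nvs.
  suff : limn s <= v - (eps / 2)%:E.
    move=> /(le_trans v_le); apply/negP; rewrite -ltNge.
    by rewrite lteBlDr// lteDl// ?lte_fin ?divr_gt0// ge0_fin_numE.
  apply: lime_le; first exact: ereal_nondecreasing_is_cvgn.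
  apply: nearW => n; rewrite leeBrDr//.
  by have /negP := nvs n; rewrite -ltNge => /ltW.
pose g e := fine (h n e).
have hfin e : h n e \is a fin_num.
  by rewrite ge0_fin_numE ?(le_lt_trans (h1 n e)) ?ltry//; exact: (hn n).1.
have gE : EFin \o g = h n by apply/funext => e; rewrite /= fineK.
have mg : measurable_fun setT g.
  by apply: (measurableT_comp (f := fine)) => //; exact: (hn n).2.
have g01 e : (0 <= g e <= 1)%R.
  by rewrite -!lee_fin fineK// (hn n).1 h1.
have gD e : D e -> g e = 1%R.
  by move=> De; rewrite /g /h (killed_hit_target T E n De).
have gE0 e : ~ E n e -> g e = 0%R.
  by move=> Ene; rewrite /g /h (killed_hit_out T DE E_nd Ene).
exists g, n; split => //.
have g2n : nnmeas (fun e => (g e ^+ 2)%:E).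
  split=> [e|]; first by rewrite lee_fin sqr_ge0.
  by apply/measurable_EFinP; exact: measurable_funX.
have tg : \int[nu]_e (tau e * (g e ^+ 2)%:E) < +oo.
  apply: le_lt_trans (tauE n); rewrite (integral_indicM nu (E n) tau).
  apply: (nn_integral_le _ measurableT (nnmeasM taun g2n)
    (nnmeasM (nnmeas_indic R (mE n)) taun)) => e _.
  have [Ene|Ene] := pselect (E n e).
    rewrite indicE mem_set// mul1e -[leRHS]mule1.
    apply: lee_wpmul2l; first exact: taun.1.
    by have /andP[g0 g1] := g01 e; rewrite lee_fin exprn_ile1.
  by rewrite gE0// expr0n /= mule0 mule_ge0//; exact: taun.1.
have g0 e : (0 <= g e)%R by have /andP[] := g01 e.
have gsub e : ~ D e -> (0 < g e)%R -> (g e)%:E <= T (EFin \o g) e.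
  move=> De ge0; rewrite gE fineK//.
  apply: (killed_hit_subharmonic T_op mD mE E_nd De).
  by rewrite -[X in _ < X]fineK//.
have := energy_le Q_posterior mf f_ge0 f_sym tau_pos mD mg g0 gD gsub voo tg.
rewrite gE -/v -/(s n).
have sn0 : 0 <= s n by apply: (iop_nn Sop (hn n)).1 tt.
have en0 : 0 <= energy P Q nu f g.
  apply: integral_ge0 => x _; apply: integral_ge0 => e _.
  by apply: integral_ge0 => t _; rewrite lee_fin mulr_ge0// sqr_ge0.
clear v_le; move: vs voo; case: v v0 => [v| |] // v0.
case: (s n) sn0 => [r| |] // r0; case: (energy P Q nu f g) en0 => [a| |] // a0.
- by rewrite -!EFinM -!EFinD !lee_fin; lra.
- by rewrite gt0_muley ?lte_fin// addey// -EFinM.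
- by rewrite gt0_muley ?lte_fin// addey// -EFinM.
Qed.

End recurrence.

(** * Blyth's method *)
Section comparison.
Context (R : realType) (d : measure_display) (T : measurableType d).
Variable nu : {measure set T -> \bar R}.

(** The excess is measured by the positive part of [r2 - r1], which satisfies
    [r2 = r1 + w] also where both risks are infinite. *)
Lemma measure_lt_eq0 (D : set T) (r1 r2 : T -> \bar R) : measurable D ->
  nnmeas r1 -> nnmeas r2 -> (forall t, r1 t <= r2 t) ->
  \int[nu]_(t in D) r2 t < +oo ->
  \int[nu]_(t in D) r2 t <= \int[nu]_(t in D) r1 t ->
  nu (D `&` [set t | r1 t < r2 t]) = 0.
Proof.
move=> mD r1n r2n r12 r2oo r21.
pose w := (r2 \- r1)^\+.
have wn : nnmeas w.
  split=> [t|]; first exact: funepos_ge0.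
  by apply: measurable_funepos; apply: emeasurable_funB; [exact: r2n.2|exact: r1n.2].
have r2E t : r2 t = r1 t + w t.
  rewrite /w funeposE /=; have [lt12|] := ltP (r1 t) (r2 t).
    have r1f : r1 t \is a fin_num.
      by rewrite ge0_fin_numE ?(lt_le_trans lt12) ?leey//; exact: r1n.1.
    rewrite max_l; last by rewrite sube_ge0 ?r1f// ltW.
    by rewrite addeC subeK.
  move=> le21; have -> : r1 t = r2 t by apply/eqP; rewrite eq_le r12.
  case: (r2 t) (r2n.1 t) => [r| |]// _; last by rewrite /= max_r ?leNye// adde0.
  by rewrite -EFinB subrr maxxx adde0.
have w0 : \int[nu]_(t in D) `|w t| = 0.
  rewrite (eq_integral w); last by move=> t _; rewrite gee0_abs//; exact: wn.1.
  move: r21 r2oo; rewrite (eq_integral (fun t => r1 t + w t)) => [|t _]; last exact: r2E.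
  rewrite nn_integralD//.
  have I10 := nn_integral_ge0 nu D r1n; have Iw0 := nn_integral_ge0 nu D wn.
  case: (\int[nu]_(t in D) r1 t) I10 => [a| |] // a0; last first.
    by case: (\int[nu]_(t in D) w t) Iw0.
  case: (\int[nu]_(t in D) w t) Iw0 => [b| |] // b0.
  rewrite -EFinD !lee_fin => ab _; congr EFin.
  by move: b0; rewrite lee_fin; lra.
have mw : measurable_fun D w by apply: measurable_funTS; exact: wn.2.
have [N [mN N0 sN]] := (ae_eq_integral_abs nu mD mw).1 w0.
apply: (subset_measure0 _ mN _ N0).
  exact: (measurable_lte mD (measurable_funTS r1n.2) (measurable_funTS r2n.2)).
move=> t [Dt /= lt12]; apply: sN => /= /(_ Dt) wt0.
by move: lt12; rewrite [r2 t]r2E wt0 adde0 ltxx.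
Qed.

(** The weight [g ^ 2] is one on [D], and off [D] it adds a nonnegative amount
    to the excess of [r2] over [r1]; so the excess over [D] is at most the
    weighted excess.  The weighted integral of [r1] is finite, as [g] vanishes
    off [E], and is cancelled. *)
Lemma blyth_comparison (D E : set T) (g : T -> R) (r1 r2 : T -> \bar R)
    (c : \bar R) : measurable D -> measurable E -> measurable_fun setT g ->
  nnmeas r1 -> nnmeas r2 -> (forall t, r1 t <= r2 t) ->
  (forall t, (0 <= g t <= 1)%R) -> (forall t, D t -> g t = 1%R) ->
  (forall t, ~ E t -> g t = 0%R) ->
  \int[nu]_(t in E) r2 t < +oo ->
  \int[nu]_t ((g t ^+ 2)%:E * r2 t) <=
    \int[nu]_t ((g t ^+ 2)%:E * r1 t) + c ->
  \int[nu]_(t in D) r2 t <= \int[nu]_(t in D) r1 t + c.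
Proof.
move=> mD mE mg r1n r2n r12 g01 gD gE r2E reg.
have g2n : nnmeas (fun t => (g t ^+ 2)%:E).
  split=> [t|]; first by rewrite lee_fin sqr_ge0.
  by apply/measurable_EFinP; exact: measurable_funX.
have w1n := nnmeasM g2n r1n; have w2n := nnmeasM g2n r2n.
have Dn : nnmeas (fun t => (\1_D t)%:E : \bar R) by exact: nnmeas_indic.
have D1n := nnmeasM Dn r1n; have D2n := nnmeasM Dn r2n.
set I1 := \int[nu]_t ((g t ^+ 2)%:E * r1 t) in reg *.
set I2 := \int[nu]_t ((g t ^+ 2)%:E * r2 t) in reg *.
have I12 : I1 <= I2.
  apply: (nn_integral_le _ measurableT w1n w2n) => t _.
  by apply: lee_wpmul2l => //; exact: g2n.1.
have I2E : I2 <= \int[nu]_(t in E) r2 t.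
  rewrite (integral_indicM nu E r2).
  apply: (nn_integral_le _ measurableT w2n (nnmeasM (nnmeas_indic R mE) r2n)) => t _.
  have [Et|Et] := pselect (E t).
    rewrite indicE mem_set//; apply: lee_wpmul2r; first exact: r2n.1.
    by have /andP[g0 g1] := g01 t; rewrite lee_fin exprn_ile1.
  by rewrite gE// expr0n /= mul0e mule_ge0 ?lee_fin//; exact: r2n.1.
have I1fin : I1 \is a fin_num.
  rewrite ge0_fin_numE; last exact: nn_integral_ge0 w1n.
  exact: le_lt_trans I12 (le_lt_trans I2E r2E).
have key : \int[nu]_(t in D) r2 t + I1 <= \int[nu]_(t in D) r1 t + I2.
  rewrite (integral_indicM nu D r2) (integral_indicM nu D r1).
  rewrite -(nn_integralD _ measurableT D2n w1n).
  rewrite -(nn_integralD _ measurableT D1n w2n).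
  apply: (nn_integral_le _ measurableT (nnmeasD D2n w1n) (nnmeasD D1n w2n)) => t _.
  have [Dt|Dt] := pselect (D t).
    by rewrite gD// expr1n !mul1e indicE mem_set// !mul1e addeC.
  rewrite indicE memNset// !mul0e !add0e.
  by apply: lee_wpmul2l => //; exact: g2n.1.
rewrite -(leeD2rE _ _ I1fin) -[leRHS]addeA (addeC c).
exact: le_trans key (leeD (lexx _) reg).
Qed.

End comparison.

Section admissibility.
Context (R : realType) (dX dT dO : measure_display).
Context (X : measurableType dX) (Theta : measurableType dT).
Context (Omega : measurableType dO).
Variables (P : R.-pker Theta ~> X) (Q : R.-pker X ~> Theta).
Variable nu : {measure set Theta -> \bar R}.
Hypothesis Q_posterior : formal_posterior P Q nu.
Variable f : Theta * Theta -> R.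
Hypotheses (mf : measurable_fun setT f) (f_ge0 : forall z, (0 <= f z)%R).
Hypothesis f_sym : forall t eta, f (t, eta) = f (eta, t).
Hypothesis tau_pos : forall e, 0 < Tnorm P Q f e < +oo.
Hypothesis tau_int : integrable_exhaustion nu (Tnorm P Q f).
Variables (Pr : Theta -> probability Omega R) (W : nat -> Omega -> Theta).
Hypothesis W_chain : markov_chain (transition_kernel P Q f) Pr W.
Hypothesis W_rec : locally_recurrent nu Pr W.

Lemma posterior_mean_admissible p (phi : Theta -> 'rV[R]_p) : Phi f phi ->
  integrable_exhaustion nu (risk P phi (posterior_mean Q phi)) ->
  almost_admissible P nu phi (posterior_mean Q phi).
Proof.
move=> [mphi [C C0 lip]] [K [mK K_nd K_cover K_fin]] delta mdelta dom.
have [K' [mK' K'_nd K'_cover K'_fin]] := tau_int.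
have mhat := measurable_posterior_mean Q mphi.
have r1n := nnmeas_risk P mphi mdelta.
have r2n := nnmeas_risk P mphi mhat.
have taun := nnmeas_Tnorm P Q mf f_ge0.
(* The exhaustion must make both the risk and [Tnorm] integrable: the first for
   the cancellation in Blyth's method, the second for finite energy. *)
pose E n := K n `&` K' n.
have mE n : measurable (E n) by exact: measurableI.
have E_nd n : E n `<=` E n.+1 by exact: setISS.
have E_le := nested_le E_nd.
have E_cover i : \bigcup_n E (i + n)%N = setT.
  apply/seteqP; split => // t _.
  have [m _ Km] : (\bigcup_n K n) t by rewrite K_cover.
  have [n _ K'n] : (\bigcup_n K' n) t by rewrite K'_cover.
  exists (m + n)%N => //; split.
    by apply: (nested_le K_nd) Km; rewrite addnCA leq_addr.
  by apply: (nested_le K'_nd) K'n; rewrite addnA leq_addl.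
have riskE n : \int[nu]_(t in E n) risk P phi (posterior_mean Q phi) t < +oo.
  apply: le_lt_trans (K_fin n).2; apply: ge0_subset_integral => //.
  - exact: measurable_funTS r2n.2.
  - by move=> t _; exact: r2n.1.
  - exact: subIsetl.
have tauE n : \int[nu]_(t in E n) Tnorm P Q f t < +oo.
  have [_ taufin] := K'_fin n; apply: le_lt_trans taufin; apply: ge0_subset_integral => //.
  - exact: measurable_funTS taun.2.
  - by move=> t _; exact: taun.1.
  - exact: subIsetr.
have rec i : locally_recurrent_set nu Pr W (E i).
  have [Ei0|Ei0] := eqVneq (nu (E i)) 0.
    by exists (E i); split => // w /not_implyP[].
  apply: W_rec; split => //; rewrite lt_neqAle eq_sym Ei0 measure_ge0 /=.
  have /andP[_ Koo] := (K_fin i).1; apply: le_lt_trans Koo.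
  by apply: le_measure; rewrite ?inE//; exact: subIsetl.
have riskD i : \int[nu]_(t in E i) risk P phi (posterior_mean Q phi) t <=
    \int[nu]_(t in E i) risk P phi delta t.
  apply/lee_addgt0Pr => eps eps0.
  have DE n : E i `<=` E (i + n)%N by apply: E_le; exact: leq_addr.
  have Es n : E (i + n)%N `<=` E (i + n.+1)%N by rewrite addnS; exact: E_nd.
  have [g [n [mg g01 gD gE gen]]] := recurrent_low_energy Q_posterior mf f_ge0
    f_sym tau_pos W_chain (mE i) (fun n => mE (i + n)%N) DE Es (E_cover i)
    (fun n => tauE (i + n)%N) (rec i) (divr_gt0 eps0 C0).
  apply: (blyth_comparison (mE i) (mE (i + n)%N) mg r1n r2n dom g01 gD gE) => //.
  have tau_fin eta : Tnorm P Q f eta < +oo by case/andP: (tau_pos eta).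
  apply: le_trans (bayes_regret_le mf f_ge0 tau_fin Q_posterior mphi C0 lip
    mg g01 mdelta) _.
  apply: leeD => //.
  apply: (@le_trans _ _ (C%:E * (eps / C)%:E)).
    by apply: lee_wpmul2l => //; rewrite lee_fin ltW.
  by rewrite -EFinM lee_fin mulrC divfK// gt_eqF.
have null i := measure_lt_eq0 (mE i) r1n r2n dom (riskE i) (riskD i).
set A := [set t | _].
have mA : measurable A.
  by have := measurable_lte measurableT r1n.2 r2n.2; rewrite setTI.
apply: (measure_negligible mA).
have -> : A = \bigcup_n (E n `&` A).
  have cover : \bigcup_n E n = setT := E_cover 0%N.
  by rewrite -setI_bigcupl cover setTI.
apply: negligible_bigcup => n; exists (E n `&` A).
by split; [exact: measurableI|exact: null|].
Qed.

End admissibility.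

(** * Strong admissibility *)

Theorem theorem3p3 (R : realType) (X Theta : ptopologicalType)
  (polishX : polish R X) (polishTheta : polish R Theta)
  (P : R.-pker (borel Theta) ~> (borel X))
  (nu : {sigma_finite_measure set (borel Theta) -> \bar R})
  (nu_improper : nu setT = +oo)
  (marginal_sigma_finite : sigma_finite setT (marginal P nu))
  (Q : R.-pker (borel X) ~> (borel Theta))
  (Q_posterior : formal_posterior P Q nu)
  (f : borel Theta * borel Theta -> R)
  (f_measurable : measurable_fun setT f)
  (f_ge0 : forall z, (0 <= f z)%R)
  (hi : forall (p : nat) (phi : borel Theta -> 'rV[R]_p),
     (1 <= p)%N -> Phi f phi ->
     integrable_exhaustion nu (risk P phi (posterior_mean Q phi)))
  (hii_pos : forall eta, 0 < Tnorm P Q f eta < +oo)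
  (hii_int : integrable_exhaustion nu (Tnorm P Q f))
  (hiii : exists2 e : R, (0 < e)%R & {ae nu, forall eta, e%:E <= Tnorm P Q f eta})
  (hiv : forall t eta, f (t, eta) = f (eta, t))
  (dO : measure_display) (Omega : measurableType dO)
  (Pr : borel Theta -> probability Omega R)
  (W : nat -> Omega -> borel Theta)
  (W_chain : markov_chain (transition_kernel P Q f) Pr W)
  (W_recurrent : locally_recurrent nu Pr W) :
  strongly_admissible P Q nu f.
Proof.
move=> p phi p1 phi_lip.
exact: (posterior_mean_admissible Q_posterior f_measurable f_ge0 hiv hii_pos
  hii_int W_chain W_recurrent phi_lip (hi p phi p1 phi_lip)).
Qed.
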